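(* Let $\mathcal C$ be a finite tensor category over a field $\Bbbk$, $\mathcal M$ a right $\mathcal C$-module category, $A\in\mathcal C$ an algebra, and $\mathrm{Mod}_A(\mathcal C)$ the left $\mathcal C$-module category of right $A$-modules in $\mathcal C$. Then the relative tensor product of $\mathcal M$ and $\mathrm{Mod}_A(\mathcal C)$ over $\mathcal C$ is equivalent to the category of $A$-module objects in $\mathcal M$: $$\mathcal M\boxtimes_{\mathcal C}\mathrm{Mod}_A(\mathcal C)\simeq\mathrm{Mod}_A(\mathcal M).$$
   Context: Conventions. $\Bbbk$ is a fixed field; all categories are finite $\Bbbk$-linear abelian (finite-dimensional morphism spaces, all objects of finite length, every object has a projective cover, finitely many isomorphism classes of simple objects), called ''linear categories''; functors and natural transformations are linear. A finite tensor category is such a category with a linear monoidal structure, simple unit, and left and right duals. Module categories have actions $\triangleright$ (left), $\triangleleft$ (right), exact in each argument, with the usual coherent constraints. An algebra in $\mathcal C$ is an associative unital algebra object; $\mathrm{Mod}_A(\mathcal C)$ is a left $\mathcal C$-module category via the tensor product of $\mathcal C$. Module objects. For a right $\mathcal C$-module category $\mathcal M$, an object of $\mathrm{Mod}_A(\mathcal M)$ is a pair $(m,\mu_m)$ with $m\in\mathcal M$ and $\mu_m:m\triangleleft A\to m$ a morphism in $\mathcal M$ satisfying the usual compatibilities with multiplication and unit of $A$; morphisms are morphisms $f:m\to n$ in $\mathcal M$ with $\mu_n\circ(f\triangleleft\mathrm{id}_A)=f\circ\mu_m$. Relative tensor product. For a right module category $\mathcal M$ and left module category $\mathcal N$ over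 $\mathcal C$, a bilinear functor $\mathsf F:\mathcal M\times\mathcal N\to\mathcal A$ is balanced if equipped with natural isomorphisms $\mathsf F(m\triangleleft c\times n)\to\mathsf F(m\times c\triangleright n)$ satisfying the pentagon and unit triangle. A relative tensor product $\mathcal M\boxtimes_{\mathcal C}\mathcal N$ is a linear category with a balanced functor $\mathsf B:\mathcal M\times\mathcal N\to\mathcal M\boxtimes_{\mathcal C}\mathcal N$ such that for every linear category $\mathcal A$, composition with $\mathsf B$ is an equivalence from right exact functors $\mathcal M\boxtimes_{\mathcal C}\mathcal N\to\mathcal A$ to balanced functors $\mathcal M\times\mathcal N\to\mathcal A$ that are right exact in each argument (together with a specified quasi-inverse forming an adjoint equivalence). *)

(* Defs.v *)
From HB Require Import structures.
From mathcomp Require Import all_boot all_order all_algebra.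
From mathcomp Require Import boolp.

Set Implicit Arguments.
Unset Strict Implicit.
Unset Printing Implicit Defensive.

Import GRing.Theory.
Local Open Scope ring_scope.

Reserved Notation "g ∘ f" (at level 40, left associativity).
Reserved Notation "x ⊗ y" (at level 37, left associativity).
Reserved Notation "f ⊗₁ g" (at level 37, left associativity).
Reserved Notation "m ◁ c" (at level 37, left associativity).
Reserved Notation "f ◁₁ g" (at level 37, left associativity).
Reserved Notation "c ▷ n" (at level 38, right associativity).
Reserved Notation "f ▷₁ g" (at level 38, right associativity).

Record category := Category {
  ob :> Type;
  hom : ob -> ob -> Type;
  idm : forall x, hom x x;
  hcomp : forall x y z, hom y z -> hom x y -> hom x z;
  hcompA : forall w x y z (h : hom y z) (g : hom x y) (f : hom w x),
    hcomp h (hcomp g f) = hcomp (hcomp h g) f;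
  hcomp1f : forall x y (f : hom x y), hcomp (idm y) f = f;
  hcompf1 : forall x y (f : hom x y), hcomp f (idm x) = f }.

Arguments hom {c} x y.
Arguments idm {c} x.
Arguments hcomp {c x y z} g f.
Notation "g ∘ f" := (hcomp g f).

Record iso (C : category) (x y : C) := Iso {
  fwd :> hom x y;
  bwd : hom y x;
  fwdK : bwd ∘ fwd = idm x;
  bwdK : fwd ∘ bwd = idm y }.

Definition is_iso (C : category) (x y : C) (f : hom x y) : Prop :=
  exists g : hom y x, g ∘ f = idm x /\ f ∘ g = idm y.

Definition mono (C : category) (x y : C) (f : hom x y) : Prop :=
  forall z (g h : hom z x), f ∘ g = f ∘ h -> g = h.

Definition epi (C : category) (x y : C) (f : hom x y) : Prop :=
  forall z (g h : hom y z), g ∘ f = h ∘ f -> g = h.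

Record functor (C D : category) := Functor {
  fob :> C -> D;
  fmap : forall x y, hom x y -> hom (fob x) (fob y);
  fmap1 : forall x, fmap (idm x) = idm (fob x);
  fmapM : forall x y z (g : hom y z) (f : hom x y),
    fmap (g ∘ f) = fmap g ∘ fmap f }.

Arguments fmap {C D} F {x y} f : rename.

Definition id_functor (C : category) : functor C C :=
  @Functor C C id (fun x y f => f) (fun=> erefl) (fun _ _ _ _ _ => erefl).

Section CompFunctor.
Variables (C D E : category) (G : functor D E) (F : functor C D).

Fact comp_functor1 x : fmap G (fmap F (idm x)) = idm (G (F x)).
Proof. by rewrite !fmap1. Qed.

Fact comp_functorM x y z (g : hom y z) (f : hom x y) :
  fmap G (fmap F (g ∘ f)) = fmap G (fmap F g) ∘ fmap G (fmap F f).
Proof. by rewrite !fmapM. Qed.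

Definition comp_functor : functor C E := Functor comp_functor1 comp_functorM.
End CompFunctor.

Record nat_trans (C D : category) (F G : functor C D) := NatTrans {
  ntc :> forall x, hom (F x) (G x);
  ntN : forall x y (f : hom x y), ntc y ∘ fmap F f = fmap G f ∘ ntc x }.

Record nat_iso (C D : category) (F G : functor C D) := NatIso {
  nat_iso_trans :> nat_trans F G;
  nat_isoP : forall x, is_iso (nat_iso_trans x) }.

Record adjoint_equivalence (C D : category) (F : functor C D) :=
  AdjointEquivalence {
  quasi_inverse : functor D C;
  ae_unit : nat_iso (id_functor C) (comp_functor quasi_inverse F);
  ae_counit : nat_iso (comp_functor F quasi_inverse) (id_functor D);
  ae_triangle1 : forall x, ae_counit (F x) ∘ fmap F (ae_unit x) = idm (F x);
  ae_triangle2 : forall y,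
    fmap quasi_inverse (ae_counit y) ∘ ae_unit (quasi_inverse y)
    = idm (quasi_inverse y) }.

Record hom_vect_category (k : fieldType) := HomVectCategory {
  hvcat :> category;
  hom_vect : forall x y : hvcat, Vector k (hom x y) }.

HB.instance Definition _ (k : fieldType) (C : hom_vect_category k) (x y : C) :=
  Vector.copy (@hom C x y) (Vector.Pack (hom_vect x y)).

(* A [k]-linear category with finite-dimensional morphism spaces ([vectType]
   includes finite-dimensionality).  The remaining conditions on a finite
   linear abelian category are collected in [finite_abelian] below. *)
Record lincat (k : fieldType) := LinCat {
  lcat :> hom_vect_category k;
  hcompPl : forall (x y z : lcat) (a : k) (g g' : hom y z) (f : hom x y),
    (a *: g + g') ∘ f = a *: (g ∘ f) + g' ∘ f;
  hcompPr : forall (x y z : lcat) (a : k) (g : hom y z) (f f' : hom x y),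
    g ∘ (a *: f + f') = a *: (g ∘ f) + g ∘ f' }.

Section LinearCategories.
Variables (k : fieldType) (C : lincat k).

Definition zero_object (x : C) : Prop :=
  forall y, (forall f : hom x y, f = 0) /\ (forall f : hom y x, f = 0).

Definition biproduct (x y z : C) : Prop :=
  exists (i1 : hom x z) (i2 : hom y z) (p1 : hom z x) (p2 : hom z y),
    [/\ p1 ∘ i1 = idm x, p2 ∘ i2 = idm y, p1 ∘ i2 = 0, p2 ∘ i1 = 0
      & i1 ∘ p1 + i2 ∘ p2 = idm z].

Definition is_kernel (x y z : C) (f : hom y z) (i : hom x y) : Prop :=
  f ∘ i = 0 /\
  forall w (g : hom w y), f ∘ g = 0 -> exists! h : hom w x, i ∘ h = g.

Definition is_cokernel (x y z : C) (f : hom x y) (p : hom y z) : Prop :=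
  p ∘ f = 0 /\
  forall w (g : hom y w), g ∘ f = 0 -> exists! h : hom z w, h ∘ p = g.

Record abelian : Prop := Abelian {
  abelian_zero : exists x, zero_object x;
  abelian_biproduct : forall x y, exists z, biproduct x y z;
  abelian_kernel : forall (y z : C) (f : hom y z),
    exists x (i : hom x y), is_kernel f i;
  abelian_cokernel : forall (x y : C) (f : hom x y),
    exists z (p : hom y z), is_cokernel f p;
  abelian_mono : forall (x y : C) (i : hom x y), mono i ->
    exists z (f : hom y z), is_kernel f i;
  abelian_epi : forall (y z : C) (p : hom y z), epi p ->
    exists x (f : hom x y), is_cokernel f p }.

Definition short_exact (x y z : C) (i : hom x y) (p : hom y z) : Prop :=
  is_kernel p i /\ is_cokernel i p.

Definition simple (x : C) : Prop :=
  ~ zero_object x /\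
  forall y (i : hom y x), mono i -> zero_object y \/ is_iso i.

Inductive finite_length : C -> Prop :=
| finite_length_zero x : zero_object x -> finite_length x
| finite_length_ext y x s (i : hom y x) (p : hom x s) :
    short_exact i p -> finite_length y -> simple s -> finite_length x.

Definition projective (P : C) : Prop :=
  forall x y (e : hom x y) (f : hom P y), epi e ->
    exists g : hom P x, e ∘ g = f.

Definition projective_cover (P x : C) (p : hom P x) : Prop :=
  [/\ projective P, epi p
    & forall y (g : hom y P), epi (p ∘ g) -> epi g].

Record finite_abelian : Prop := FiniteAbelian {
  fa_abelian : abelian;
  fa_length : forall x, finite_length x;
  fa_cover : forall x, exists P (p : hom P x), projective_cover p;
  fa_simple : exists (n : nat) (S : 'I_n -> C),
    forall x, simple x -> exists i, inhabited (iso x (S i)) }.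

End LinearCategories.

Section LinearFunctors.
Variable k : fieldType.

Record linfunctor (C D : lincat k) := LinFunctor {
  lfun :> functor C D;
  fmapP : forall (x y : C) (a : k) (f g : hom x y),
    fmap lfun (a *: f + g) = a *: fmap lfun f + fmap lfun g }.

Definition left_exact (C D : lincat k) (F : linfunctor C D) : Prop :=
  forall (x y z : C) (f : hom y z) (i : hom x y),
    is_kernel f i -> is_kernel (fmap F f) (fmap F i).

Definition right_exact (C D : lincat k) (F : linfunctor C D) : Prop :=
  forall (x y z : C) (f : hom x y) (p : hom y z),
    is_cokernel f p -> is_cokernel (fmap F f) (fmap F p).

Definition exact (C D : lincat k) (F : linfunctor C D) : Prop :=
  left_exact F /\ right_exact F.

Definition linear_equivalent (C D : lincat k) : Prop :=
  exists (F : linfunctor C D) (G : linfunctor D C),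
    inhabited (nat_iso (id_functor C) (comp_functor G F)) /\
    inhabited (nat_iso (comp_functor F G) (id_functor D)).

Record bifunctor (M N P : lincat k) := Bifunctor {
  bob :> M -> N -> P;
  bmap : forall m m' n n', hom m m' -> hom n n' -> hom (bob m n) (bob m' n');
  bmap1 : forall m n, bmap (idm m) (idm n) = idm (bob m n);
  bmapM : forall m m' m'' n n' n''
    (f' : hom m' m'') (f : hom m m') (g' : hom n' n'') (g : hom n n'),
    bmap (f' ∘ f) (g' ∘ g) = bmap f' g' ∘ bmap f g;
  bmapPl : forall m m' n n' (a : k) (f f' : hom m m') (g : hom n n'),
    bmap (a *: f + f') g = a *: bmap f g + bmap f' g;
  bmapPr : forall m m' n n' (a : k) (f : hom m m') (g g' : hom n n'),
    bmap f (a *: g + g') = a *: bmap f g + bmap f g' }.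

End LinearFunctors.

Arguments bmap {k M N P} b {m m' n n'} f g.

Section BifunctorTheory.
Variables (k : fieldType) (M N P : lincat k) (F : bifunctor M N P).

Fact bfixlM m x y z (g : hom y z) (f : hom x y) :
  bmap F (idm m) (g ∘ f) = bmap F (idm m) g ∘ bmap F (idm m) f.
Proof. by rewrite -bmapM hcomp1f. Qed.

Fact bfixrM n x y z (g : hom y z) (f : hom x y) :
  bmap F (g ∘ f) (idm n) = bmap F g (idm n) ∘ bmap F f (idm n).
Proof. by rewrite -bmapM hcomp1f. Qed.

Definition bfixl (m : M) : linfunctor N P :=
  @LinFunctor k N P
    (@Functor N P (F m) (fun x y => bmap F (idm m)) (bmap1 F m) (@bfixlM m))
    (fun x y a f g => bmapPr F a (idm m) f g).

Definition bfixr (n : N) : linfunctor M P :=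
  @LinFunctor k M P
    (@Functor M P (F^~ n) (fun x y => (bmap F)^~ (idm n)) (bmap1 F ^~ n)
       (@bfixrM n))
    (fun x y a f g => bmapPl F a f g (idm n)).

Definition right_exact2 : Prop :=
  (forall m, right_exact (bfixl m)) /\ (forall n, right_exact (bfixr n)).

Definition exact2 : Prop :=
  (forall m, exact (bfixl m)) /\ (forall n, exact (bfixr n)).

End BifunctorTheory.

Record monoidal_category (k : fieldType) := MonoidalCategory {
  mcat :> lincat k;
  tensor : bifunctor mcat mcat mcat;
  tunit : mcat;
  tassoc : forall x y z,
    iso (tensor (tensor x y) z) (tensor x (tensor y z));
  tlunit : forall x, iso (tensor tunit x) x;
  trunit : forall x, iso (tensor x tunit) x;
  tassocN : forall x x' y y' z z'
    (f : hom x x') (g : hom y y') (h : hom z z'),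
    tassoc x' y' z' ∘ bmap tensor (bmap tensor f g) h
    = bmap tensor f (bmap tensor g h) ∘ tassoc x y z;
  tlunitN : forall x x' (f : hom x x'),
    tlunit x' ∘ bmap tensor (idm tunit) f = f ∘ tlunit x;
  trunitN : forall x x' (f : hom x x'),
    trunit x' ∘ bmap tensor f (idm tunit) = f ∘ trunit x;
  tpentagon : forall w x y z,
    tassoc w x (tensor y z) ∘ tassoc (tensor w x) y z
    = bmap tensor (idm w) (tassoc x y z) ∘ tassoc w (tensor x y) z
      ∘ bmap tensor (tassoc w x y) (idm z);
  ttriangle : forall x y,
    bmap tensor (idm x) (tlunit y) ∘ tassoc x tunit y
    = bmap tensor (trunit x) (idm y) }.

Arguments tensor {k} m.
Arguments tunit {k m}.
Arguments tassoc {k m} x y z.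
Arguments tlunit {k m} x.
Arguments trunit {k m} x.

Notation "x ⊗ y" := (bob (tensor _) x y).
Notation "f ⊗₁ g" := (bmap (tensor _) f g).

(* [y] is a left dual of [x]; equivalently, [x] is a right dual of [y]. *)
Definition is_left_dual (k : fieldType) (C : monoidal_category k) (x y : C) :
    Prop :=
  exists (ev : hom (y ⊗ x) tunit) (coev : hom tunit (x ⊗ y)),
    trunit x ∘ (idm x ⊗₁ ev) ∘ tassoc x y x ∘ (coev ⊗₁ idm x)
      ∘ bwd (tlunit x) = idm x
    /\ tlunit y ∘ (ev ⊗₁ idm y) ∘ bwd (tassoc y x y) ∘ (idm y ⊗₁ coev)
      ∘ bwd (trunit y) = idm y.

Record finite_tensor_category (k : fieldType) := FiniteTensorCategory {
  ftcat :> monoidal_category k;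
  ft_finite : finite_abelian ftcat;
  ft_simple : simple (tunit : ftcat);
  ft_left_dual : forall x : ftcat, exists y, is_left_dual x y;
  ft_right_dual : forall x : ftcat, exists y, is_left_dual y x }.

Record algebra (k : fieldType) (C : monoidal_category k) := Algebra {
  alg :> C;
  amul : hom (alg ⊗ alg) alg;
  aone : hom tunit alg;
  amulA : amul ∘ (amul ⊗₁ idm alg)
          = amul ∘ (idm alg ⊗₁ amul) ∘ tassoc alg alg alg;
  amul1l : amul ∘ (aone ⊗₁ idm alg) = tlunit alg;
  amul1r : amul ∘ (idm alg ⊗₁ aone) = trunit alg }.

(* Actions of a linear monoidal category with their coherence; a module
   category is a finite abelian category with an action that is exact in each
   argument, see [right_module_category]. *)

Record right_action (k : fieldType) (C : monoidal_category k) := RightAction {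
  racat :> lincat k;
  ract : bifunctor racat C racat;
  rassoc : forall m c d, iso (ract (ract m c) d) (ract m (c ⊗ d));
  runit : forall m, iso (ract m tunit) m;
  rassocN : forall m m' c c' d d'
    (f : hom m m') (g : hom c c') (h : hom d d'),
    rassoc m' c' d' ∘ bmap ract (bmap ract f g) h
    = bmap ract f (g ⊗₁ h) ∘ rassoc m c d;
  runitN : forall m m' (f : hom m m'),
    runit m' ∘ bmap ract f (idm tunit) = f ∘ runit m;
  rpentagon : forall m c d e,
    rassoc m c (d ⊗ e) ∘ rassoc (ract m c) d e
    = bmap ract (idm m) (tassoc c d e) ∘ rassoc m (c ⊗ d) e
      ∘ bmap ract (rassoc m c d) (idm e);
  rtriangle : forall m c,
    bmap ract (idm m) (tlunit c) ∘ rassoc m tunit c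
    = bmap ract (runit m) (idm c) }.

Record left_action (k : fieldType) (C : monoidal_category k) := LeftAction {
  lacat :> lincat k;
  lact : bifunctor C lacat lacat;
  lassoc : forall c d n, iso (lact (c ⊗ d) n) (lact c (lact d n));
  lunit : forall n, iso (lact tunit n) n;
  lassocN : forall c c' d d' n n'
    (f : hom c c') (g : hom d d') (h : hom n n'),
    lassoc c' d' n' ∘ bmap lact (f ⊗₁ g) h
    = bmap lact f (bmap lact g h) ∘ lassoc c d n;
  lunitN : forall n n' (f : hom n n'),
    lunit n' ∘ bmap lact (idm tunit) f = f ∘ lunit n;
  lpentagon : forall c d e n,
    lassoc c d (lact e n) ∘ lassoc (c ⊗ d) e n
    = bmap lact (idm c) (lassoc d e n) ∘ lassoc c (d ⊗ e) n
      ∘ bmap lact (tassoc c d e) (idm n);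
  ltriangle : forall c n,
    bmap lact (idm c) (lunit n) ∘ lassoc c tunit n
    = bmap lact (trunit c) (idm n) }.

Arguments ract {k C} r.
Arguments rassoc {k C r} m c d.
Arguments runit {k C r} m.
Arguments lact {k C} l.
Arguments lassoc {k C l} c d n.
Arguments lunit {k C l} n.

Notation "m ◁ c" := (bob (ract _) m c).
Notation "f ◁₁ g" := (bmap (ract _) f g).
Notation "c ▷ n" := (bob (lact _) c n).
Notation "f ▷₁ g" := (bmap (lact _) f g).

Record right_module_category (k : fieldType) (C : monoidal_category k) :=
  RightModuleCategory {
  rmcat :> right_action C;
  rm_finite : finite_abelian rmcat;
  rm_exact : exact2 (ract rmcat) }.

Definition regular_action (k : fieldType) (C : monoidal_category k) :
    right_action C :=
  @RightAction k C C (tensor C) (@tassoc k C) (@trunit k C)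
    (@tassocN k C) (@trunitN k C) (@tpentagon k C) (@ttriangle k C).

Section Modules.
Variables (k : fieldType) (C : monoidal_category k) (A : algebra C).
Variable M : right_action C.

Record module_object := ModuleObject {
  mobj :> M;
  mact : hom (mobj ◁ A) mobj;
  mactA : mact ∘ (mact ◁₁ idm (A : C))
          = mact ∘ (idm mobj ◁₁ amul A) ∘ rassoc mobj A A;
  mact1 : mact ∘ (idm mobj ◁₁ aone A) = runit mobj }.

Definition module_defect (m n : module_object) (f : hom (m : M) n) :
    hom (m ◁ A) n :=
  mact n ∘ (f ◁₁ idm (A : C)) - f ∘ mact m.

Fact module_defect_is_linear m n : linear (@module_defect m n).
Proof.
move=> a f g; rewrite /module_defect bmapPl hcompPr hcompPl scalerBr.
by rewrite opprD addrACA.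
Qed.

HB.instance Definition _ (m n : module_object) :=
  GRing.isLinear.Build k (hom (m : M) n) (hom (m ◁ A) n) _
    (@module_defect m n) (@module_defect_is_linear m n).

(* The module morphisms, as the kernel of a linear map (see [mem_module_hom]),
   so that the hom-sets of [modules] inherit a [vectType] structure. *)
Definition module_hom (m n : module_object) : {vspace hom (m : M) n} :=
  lker (linfun (@module_defect m n)).

Lemma mem_module_hom (m n : module_object) (f : hom (m : M) n) :
  f \in module_hom m n <-> mact n ∘ (f ◁₁ idm (A : C)) = f ∘ mact m.
Proof.
rewrite memv_ker lfunE /= /module_defect subr_eq0.
by split=> [/eqP|->].
Qed.

Fact module_id_subproof (m : module_object) : idm (m : M) \in module_hom m m.
Proof. by apply/mem_module_hom; rewrite bmap1 hcompf1 hcomp1f. Qed.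

Fact module_comp_subproof m n p
    (g : subvs_of (module_hom n p)) (f : subvs_of (module_hom m n)) :
  vsval g ∘ vsval f \in module_hom m p.
Proof.
apply/mem_module_hom; rewrite bfixrM hcompA.
have /mem_module_hom -> := valP g.
by rewrite -hcompA; have /mem_module_hom -> := valP f; rewrite hcompA.
Qed.

Definition modules_category : category.
refine (@Category module_object (fun m n => subvs_of (module_hom m n))
  (fun m => Subvs (module_id_subproof m))
  (fun m n p g f => Subvs (module_comp_subproof g f)) _ _ _).
- by move=> w x y z h g f; apply: val_inj; rewrite /= hcompA.
- by move=> x y f; apply: val_inj; rewrite /= hcomp1f.
- by move=> x y f; apply: val_inj; rewrite /= hcompf1.
Defined.

Definition modules_hom_vect : hom_vect_category k :=
  @HomVectCategory k modules_category
    (fun m n => Vector.class (subvs_of (module_hom m n))).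

Definition modules : lincat k.
refine (@LinCat k modules_hom_vect _ _).
- by move=> x y z a g g' f; apply: val_inj; exact: hcompPl.
- by move=> x y z a g f f'; apply: val_inj; exact: hcompPr.
Defined.

End Modules.

Section MonoidalTheory.
Variables (k : fieldType) (C : monoidal_category k).
Implicit Types x y z c d : C.

Lemma iso_epi (D : category) (x y : D) (i : iso x y) : epi (fwd i).
Proof.
by move=> z g h e; rewrite -(hcompf1 g) -(hcompf1 h) -(bwdK i) !hcompA e.
Qed.

Lemma iso_mono (D : category) (x y : D) (i : iso x y) : mono (fwd i).
Proof.
by move=> z g h e; rewrite -(hcomp1f g) -(hcomp1f h) -(fwdK i) -!hcompA e.
Qed.

Lemma tunit_faithfulr x y (f g : hom x y) :
  f ⊗₁ idm tunit = g ⊗₁ idm (tunit : C) -> f = g.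
Proof. by move=> e; apply: (@iso_epi _ _ _ (trunit x)); rewrite -!trunitN e. Qed.

Lemma tunit_faithfull x y (f g : hom x y) :
  idm tunit ⊗₁ f = idm (tunit : C) ⊗₁ g -> f = g.
Proof. by move=> e; apply: (@iso_epi _ _ _ (tlunit x)); rewrite -!tlunitN e. Qed.

Lemma trunit_tensor x y :
  (idm x ⊗₁ trunit y) ∘ tassoc x y tunit = trunit (x ⊗ y).
Proof.
apply: tunit_faithfulr; rewrite bfixrM -[RHS]ttriangle.
apply: (@iso_mono _ _ _ (tassoc x y tunit)).
rewrite !hcompA tassocN -(ttriangle y) bfixlM.
rewrite -!hcompA (hcompA (idm x ⊗₁ tassoc y _ _)) -tpentagon.
by rewrite !hcompA -tassocN bmap1.
Qed.

Lemma tlunit_tensor x y :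
  tlunit (x ⊗ y) ∘ tassoc tunit x y = tlunit x ⊗₁ idm y.
Proof.
apply: tunit_faithfull; rewrite bfixlM.
apply: (@iso_epi _ _ _ (tassoc tunit (tunit ⊗ x) y)).
have e : epi (tassoc tunit tunit x ⊗₁ idm y).
  move=> z g h E; rewrite -(hcompf1 g) -(hcompf1 h) -bmap1 -(bwdK (tassoc _ _ _)).
  by rewrite bfixrM !hcompA E.
apply: e; rewrite -!hcompA (hcompA (_ ⊗₁ fwd (tassoc _ x y))) -tpentagon.
rewrite !hcompA ttriangle -(tassocN (idm tunit)) -[RHS]hcompA -bfixrM.
by rewrite ttriangle tassocN bmap1.
Qed.

End MonoidalTheory.

Section RegularModules.
Variables (k : fieldType) (C : monoidal_category k) (A : algebra C).
Implicit Types c d : C.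

Local Notation RA := (modules A (regular_action C)).

Definition tensor_mact c (x : C) (m : hom (x ⊗ A) x) :
    hom ((c ⊗ x) ⊗ A) (c ⊗ x) :=
  (idm c ⊗₁ m) ∘ tassoc c x A.

Fact tensor_mactA c (x : C) (m : hom (x ⊗ A) x) :
    m ∘ (m ⊗₁ idm (A : C)) = m ∘ (idm x ⊗₁ amul A) ∘ tassoc x A A ->
  tensor_mact c m ∘ (tensor_mact c m ⊗₁ idm (A : C))
  = tensor_mact c m ∘ (idm (c ⊗ x) ⊗₁ amul A) ∘ tassoc (c ⊗ x) A A.
Proof.
move=> mA; rewrite /tensor_mact bfixrM hcompA -(hcompA _ (tassoc _ _ _)) tassocN.
rewrite hcompA -bfixlM mA !bfixlM -!hcompA (hcompA (_ ⊗₁ fwd (tassoc _ _ _))).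
rewrite -tpentagon -bmap1 !hcompA -(hcompA _ _ (bmap _ _ (amul A))).
by rewrite tassocN !hcompA.
Qed.

Fact tensor_mact1 c (x : C) (m : hom (x ⊗ A) x) :
  m ∘ (idm x ⊗₁ aone A) = trunit x ->
  tensor_mact c m ∘ (idm (c ⊗ x) ⊗₁ aone A) = trunit (c ⊗ x).
Proof.
move=> m1; rewrite /tensor_mact -bmap1 -hcompA tassocN hcompA -bfixlM m1.
exact: trunit_tensor.
Qed.

Definition tensor_module c (x : RA) : RA :=
  @ModuleObject k C A (regular_action C) (c ⊗ mobj x)
    (tensor_mact c (mact x)) (tensor_mactA c (mactA x))
    (tensor_mact1 c (mact1 x)).

Fact tensor_module_hom_subproof c c' (x x' : RA) (f : hom c c')
    (g : subvs_of (module_hom x x')) :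
  f ⊗₁ vsval g \in module_hom (tensor_module c x) (tensor_module c' x').
Proof.
apply/mem_module_hom; have /mem_module_hom /= e := valP g.
rewrite /= /tensor_mact.
rewrite -hcompA tassocN !hcompA -!bmapM hcomp1f hcompf1.
by congr (_ ∘ _); congr (bmap _ _ _); exact: e.
Qed.

Definition tensor_module_hom c c' (x x' : RA) (f : hom c c') (g : hom x x') :
    hom (tensor_module c x) (tensor_module c' x') :=
  Subvs (tensor_module_hom_subproof f g).

Definition tensor_module_bifunctor : bifunctor C RA RA.
refine (@Bifunctor k C RA RA tensor_module tensor_module_hom _ _ _ _).
- by move=> c x; apply: val_inj; exact: bmap1.
- by move=> *; apply: val_inj; exact: bmapM.
- by move=> *; apply: val_inj; exact: bmapPl.
- by move=> *; apply: val_inj; exact: bmapPr.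
Defined.

Fact modules_iso_subproof (x y : RA) (i : iso (mobj x : C) (mobj y : C)) :
  fwd i \in module_hom x y -> bwd i \in module_hom y x.
Proof.
move=> hi; apply/mem_module_hom; apply: (@iso_mono _ _ _ i).
rewrite !hcompA bwdK hcomp1f.
have /mem_module_hom <- := hi.
by rewrite -hcompA -bfixrM bwdK bmap1 hcompf1.
Qed.

Definition modules_iso (x y : RA) (i : iso (mobj x : C) (mobj y : C))
  (hi : fwd i \in module_hom x y) : iso x y.
refine (@Iso RA x y (Subvs hi) (Subvs (modules_iso_subproof hi)) _ _).
- by apply: val_inj; exact: fwdK.
- by apply: val_inj; exact: bwdK.
Defined.

Fact tensor_module_assoc_subproof c d (x : RA) :
  fwd (tassoc c d (mobj x))
    \in module_hom (tensor_module (c ⊗ d) x)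
          (tensor_module c (tensor_module d x)).
Proof.
apply/mem_module_hom => /=. rewrite /tensor_mact bfixlM.
rewrite -!hcompA (hcompA (_ ⊗₁ fwd (tassoc _ _ _))) -tpentagon.
by rewrite !hcompA -tassocN bmap1.
Qed.

Fact tensor_module_unit_subproof (x : RA) :
  fwd (tlunit (mobj x)) \in module_hom (tensor_module tunit x) x.
Proof.
apply/mem_module_hom; rewrite /= /tensor_mact hcompA tlunitN -hcompA.
by rewrite tlunit_tensor.
Qed.

Definition left_modules_action : left_action C.
refine (@LeftAction k C RA tensor_module_bifunctor
  (fun c d x => modules_iso (tensor_module_assoc_subproof c d x))
  (fun x => modules_iso (tensor_module_unit_subproof x)) _ _ _ _).
- by move=> *; apply: val_inj => /=; exact: tassocN.
- by move=> *; apply: val_inj => /=; exact: tlunitN.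
- by move=> *; apply: val_inj => /=; exact: tpentagon.
- by move=> *; apply: val_inj => /=; exact: ttriangle.
Defined.

End RegularModules.

Section NatTrans.
Variables (C D : category).

Lemma nat_trans_eq (F G : functor C D) (a b : nat_trans F G) :
  (forall x, a x = b x) -> a = b.
Proof.
case: a b => [a aN] [b bN] /= ab.
have {}ab : a = b by apply: functional_extensionality_dep.
by subst b; congr NatTrans; exact: Prop_irrelevance.
Qed.

Definition nat_trans_id (F : functor C D) : nat_trans F F.
refine (@NatTrans C D F F (fun x => idm (F x)) _).
by move=> *; rewrite hcomp1f hcompf1.
Defined.

Definition nat_trans_comp (F G H : functor C D)
    (b : nat_trans G H) (a : nat_trans F G) : nat_trans F H.
refine (@NatTrans C D F H (fun x => b x ∘ a x) _).
by move=> *; rewrite -hcompA ntN hcompA ntN -hcompA.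
Defined.

End NatTrans.

Section RightExactFunctors.
Variables (k : fieldType) (C D : lincat k).

Record rex_functor := RexFunctor {
  rex_fun :> linfunctor C D;
  rexP : right_exact rex_fun }.

Definition rex_category : category.
refine (@Category rex_functor (fun F G => nat_trans F G)
  (fun F => nat_trans_id F)
  (fun F G H b a => nat_trans_comp b a) _ _ _).
- by move=> *; apply: nat_trans_eq => x /=; rewrite hcompA.
- by move=> *; apply: nat_trans_eq => x /=; rewrite hcomp1f.
- by move=> *; apply: nat_trans_eq => x /=; rewrite hcompf1.
Defined.

End RightExactFunctors.

Section BalancedFunctors.
Variables (k : fieldType) (C : monoidal_category k).
Variables (M : right_action C) (N : left_action C) (D : lincat k).

Record balanced_functor := BalancedFunctor {
  bal_fun :> bifunctor M N D;
  bal : forall m (c : C) n, iso (bal_fun (m ◁ c) n) (bal_fun m (c ▷ n));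
  balN : forall m m' (c c' : C) n n'
    (f : hom m m') (g : hom c c') (h : hom n n'),
    bal m' c' n' ∘ bmap bal_fun (f ◁₁ g) h
    = bmap bal_fun f (g ▷₁ h) ∘ bal m c n;
  bal_pentagon : forall m (c d : C) n,
    bal m c (d ▷ n) ∘ bal (m ◁ c) d n
    = bmap bal_fun (idm m) (lassoc c d n) ∘ bal m (c ⊗ d) n
      ∘ bmap bal_fun (rassoc m c d) (idm n);
  bal_triangle : forall m n,
    bmap bal_fun (idm m) (lunit n) ∘ bal m tunit n
    = bmap bal_fun (runit m) (idm n) }.

Record rex_balanced := RexBalanced {
  rexb_fun :> balanced_functor;
  rexbP : right_exact2 rexb_fun }.

Record balanced_trans (F G : balanced_functor) := BalancedTrans {
  btc :> forall m n, hom (F m n) (G m n);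
  btN : forall m m' n n' (f : hom m m') (g : hom n n'),
    btc m' n' ∘ bmap F f g = bmap G f g ∘ btc m n;
  btB : forall m (c : C) n,
    btc m (c ▷ n) ∘ bal F m c n = bal G m c n ∘ btc (m ◁ c) n }.

Lemma balanced_trans_eq (F G : balanced_functor) (a b : balanced_trans F G) :
  (forall m n, a m n = b m n) -> a = b.
Proof.
case: a b => [a aN aB] [b bN bB] /= ab.
have {}ab : a = b.
  apply: functional_extensionality_dep => m.
  by apply: functional_extensionality_dep.
by subst b; congr BalancedTrans; exact: Prop_irrelevance.
Qed.

Definition balanced_trans_id (F : balanced_functor) : balanced_trans F F.
refine (@BalancedTrans F F (fun m n => idm (F m n)) _ _).
- by move=> *; rewrite hcomp1f hcompf1.
- by move=> *; rewrite hcomp1f hcompf1.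
Defined.

Definition balanced_trans_comp (F G H : balanced_functor)
    (b : balanced_trans G H) (a : balanced_trans F G) : balanced_trans F H.
refine (@BalancedTrans F H (fun m n => b m n ∘ a m n) _ _).
- by move=> *; rewrite -hcompA btN hcompA btN -hcompA.
- by move=> *; rewrite -hcompA btB hcompA btB -hcompA.
Defined.

Definition rex_balanced_category : category.
refine (@Category rex_balanced (fun F G => balanced_trans F G)
  (fun F => balanced_trans_id F)
  (fun F G H b a => balanced_trans_comp b a) _ _ _).
- by move=> *; apply: balanced_trans_eq => m n /=; rewrite hcompA.
- by move=> *; apply: balanced_trans_eq => m n /=; rewrite hcomp1f.
- by move=> *; apply: balanced_trans_eq => m n /=; rewrite hcompf1.
Defined.

End BalancedFunctors.

Section Precomposition.
Variables (k : fieldType) (C : monoidal_category k).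
Variables (M : right_action C) (N : left_action C) (T D : lincat k).
Variable B : rex_balanced M N T.

Definition fmap_iso (X Y : category) (F : functor X Y) (x y : X)
    (i : iso x y) : iso (F x) (F y).
refine (@Iso Y (F x) (F y) (fmap F i) (fmap F (bwd i)) _ _).
- by rewrite -fmapM fwdK fmap1.
- by rewrite -fmapM bwdK fmap1.
Defined.

Definition comp_bifunctor (F : linfunctor T D) : bifunctor M N D.
refine (@Bifunctor k M N D (fun m n => F (B m n))
  (fun m m' n n' f g => fmap F (bmap B f g)) _ _ _ _).
- by move=> *; rewrite bmap1 fmap1.
- by move=> *; rewrite bmapM fmapM.
- by move=> *; rewrite bmapPl fmapP.
- by move=> *; rewrite bmapPr fmapP.
Defined.

Definition comp_balanced (F : linfunctor T D) : balanced_functor M N D.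
refine (@BalancedFunctor k C M N D (comp_bifunctor F)
  (fun m c n => fmap_iso F (bal B m c n)) _ _ _).
- by move=> * /=; rewrite -!fmapM balN.
- by move=> * /=; rewrite -!fmapM bal_pentagon.
- by move=> * /=; rewrite -!fmapM bal_triangle.
Defined.

Fact comp_rex_balancedP (F : rex_functor T D) : right_exact2 (comp_balanced F).
Proof.
have [Bl Br] := rexbP B.
by split=> [m|n] x y z f p fp; apply: (rexP F); [exact: Bl | exact: Br].
Qed.

Definition comp_rex_balanced (F : rex_functor T D) : rex_balanced M N D :=
  RexBalanced (comp_rex_balancedP F).

Definition comp_balanced_trans (F G : linfunctor T D) (a : nat_trans F G) :
  balanced_trans (comp_balanced F) (comp_balanced G).
refine (@BalancedTrans k C M N D (comp_balanced F) (comp_balanced G)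
  (fun m n => a (B m n)) _ _).
- by move=> * /=; rewrite ntN.
- by move=> * /=; rewrite ntN.
Defined.

Definition precomp :
  functor (rex_category T D) (rex_balanced_category M N D).
refine (@Functor (rex_category T D) (rex_balanced_category M N D)
  comp_rex_balanced (fun F G a => comp_balanced_trans a) _ _).
- by move=> F; apply: balanced_trans_eq.
- by move=> F G H b a; apply: balanced_trans_eq.
Defined.

End Precomposition.

(* [rtp_univ] is data, a chosen quasi-inverse included.  That [rtp_fun] is right
   exact in each argument is needed for [precomp] to preserve right exactness. *)
Record relative_tensor_product (k : fieldType) (C : monoidal_category k)
    (M : right_action C) (N : left_action C) := RelativeTensorProduct {
  rtp :> lincat k;
  rtp_finite : finite_abelian rtp;
  rtp_fun : rex_balanced M N rtp;
  rtp_univ : forall D : lincat k, finite_abelian D ->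
    adjoint_equivalence (precomp D rtp_fun) }.

(* Main.v *)
(* The balanced functor is B(m, x) = m ◁ x.  Every A-module n in M is the
   coequalizer of the two evident maps (n ◁ A) ◁ A -> n ◁ A, that is, of
   B(n ◁ A, A) -> B(n, A); this forces a right exact functor F with
   F ∘ B = G to send n to the cokernel of
     G(n ◁ A, A) -> G(n, A),   G(mu_n, 1) - G(1, mul) ∘ bal,
   and determines transformations F -> F' from their restriction along B.
   Conversely this cokernel is right exact in n, and at n = m ◁ x it is
   G(m, x), because bal identifies the diagram with G(m, -) applied to the
   presentation of x by the free modules (x ⊗ A) ⊗ A and x ⊗ A.  Rigidity of C
   enters only in making - ⊗ A right exact, so that cokernels in Mod_A(C) are
   computed in C.
   Mod_A(M) is finite abelian because M is: kernels and cokernels are created by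
   the forgetful functor, and the free modules on projectives P_i of M generate.
   Finite length, simples and projective covers are then controlled by the
   additive invariant sum_i dim Hom(P_i ◁ A, -). *)
From HB Require Import structures.
From mathcomp Require Import all_boot all_order all_algebra.
From mathcomp Require Import boolp.
Require Import Defs.

Set Implicit Arguments.
Unset Strict Implicit.
Unset Printing Implicit Defensive.

Import GRing.Theory.
Local Open Scope ring_scope.

(** * Abelian categories *)

Section CategoryTheory.
Variable C : category.
Implicit Types x y z : C.

Definition iso_inv x y (i : iso x y) : iso y x := Iso (bwdK i) (fwdK i).

Lemma is_iso_iso x y (f : hom x y) : is_iso f -> exists i : iso x y, fwd i = f.
Proof. by case=> g [gf fg]; exists (Iso gf fg). Qed.

Lemma iso_is_iso x y (i : iso x y) : is_iso (fwd i).
Proof. by exists (bwd i); rewrite fwdK bwdK. Qed.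

Lemma is_iso_comp x y z (g : hom y z) (f : hom x y) :
  is_iso g -> is_iso f -> is_iso (g ∘ f).
Proof.
move=> [g' [g'g gg']] [f' [f'f ff']]; exists (f' ∘ g'); split.
  by rewrite hcompA -(hcompA f') g'g hcompf1.
by rewrite hcompA -(hcompA g) ff' hcompf1.
Qed.

Lemma epi_comp x y z (g : hom y z) (f : hom x y) :
  epi g -> epi f -> epi (g ∘ f).
Proof. by move=> eg ef w h h'; rewrite !hcompA => /ef /eg. Qed.

Lemma epi_cancel x y z (g : hom y z) (f : hom x y) : epi (g ∘ f) -> epi g.
Proof. by move=> e w h h' E; apply: e; rewrite !hcompA E. Qed.

Lemma mono_comp x y z (g : hom y z) (f : hom x y) :
  mono g -> mono f -> mono (g ∘ f).
Proof. by move=> eg ef w h h'; rewrite -!hcompA => /eg /ef. Qed.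

Lemma is_iso_epi x y (f : hom x y) : is_iso f -> epi f.
Proof. by move=> /is_iso_iso [i <-]; exact: iso_epi. Qed.

Lemma is_iso_mono x y (f : hom x y) : is_iso f -> mono f.
Proof. by move=> /is_iso_iso [i <-]; exact: iso_mono. Qed.

Lemma mono_split_iso x y (f : hom x y) (g : hom y x) :
  mono f -> f ∘ g = idm y -> is_iso f.
Proof.
move=> mf fg; exists g; split=> //; apply: mf.
by rewrite hcompA fg hcomp1f hcompf1.
Qed.

End CategoryTheory.

(** * Kernels, cokernels and images in linear categories *)

Section LinearCategoryTheory.
Variables (k : fieldType) (C : lincat k).
Implicit Types x y z w s t : C.

Lemma hcompDl x y z (g g' : hom y z) (f : hom x y) :
  (g + g') ∘ f = g ∘ f + g' ∘ f.
Proof. by rewrite -[g]scale1r hcompPl !scale1r. Qed.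

Lemma hcompDr x y z (g : hom y z) (f f' : hom x y) :
  g ∘ (f + f') = g ∘ f + g ∘ f'.
Proof. by rewrite -[f]scale1r hcompPr !scale1r. Qed.

Lemma hcomp0f x y z (f : hom x y) : (0 : hom y z) ∘ f = 0.
Proof. by apply: (addrI (0 ∘ f)); rewrite -hcompDl !addr0. Qed.

Lemma hcompf0 x y z (f : hom y z) : f ∘ (0 : hom x y) = 0.
Proof. by apply: (addrI (f ∘ 0)); rewrite -hcompDr !addr0. Qed.

Lemma hcompBl x y z (g g' : hom y z) (f : hom x y) :
  (g - g') ∘ f = g ∘ f - g' ∘ f.
Proof.
by apply: (addIr (g' ∘ f)); rewrite -hcompDl !subrK.
Qed.

Lemma hcompBr x y z (g : hom y z) (f f' : hom x y) :
  g ∘ (f - f') = g ∘ f - g ∘ f'.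
Proof.
by apply: (addIr (g ∘ f')); rewrite -hcompDr !subrK.
Qed.

Lemma fmap0 (D : lincat k) (F : linfunctor C D) x y :
  fmap F (0 : hom x y) = 0.
Proof.
by rewrite -(addNr 0) -[- 0]scaleN1r fmapP scaleN1r addNr.
Qed.

Lemma fmapB (D : lincat k) (F : linfunctor C D) x y (f g : hom x y) :
  fmap F (f - g) = fmap F f - fmap F g.
Proof. by rewrite addrC -scaleN1r fmapP scaleN1r addrC. Qed.

Lemma epi0P x y (f : hom x y) :
  epi f <-> forall w (g : hom y w), g ∘ f = 0 -> g = 0.
Proof.
split=> [ef w g gf | H w g h E]; first by apply: ef; rewrite hcomp0f.
by apply/eqP; rewrite -subr_eq0; apply/eqP/H; rewrite hcompBl E subrr.
Qed.

Lemma mono0P x y (f : hom x y) :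
  mono f <-> forall w (g : hom w x), f ∘ g = 0 -> g = 0.
Proof.
split=> [ef w g gf | H w g h E]; first by apply: ef; rewrite hcompf0.
by apply/eqP; rewrite -subr_eq0; apply/eqP/H; rewrite hcompBr E subrr.
Qed.

Lemma kernel_mono x y z (f : hom y z) (i : hom x y) : is_kernel f i -> mono i.
Proof.
case=> fi H w g h E.
have [|j [_ ju]] := H w (i ∘ g); first by rewrite hcompA fi hcomp0f.
by rewrite -(ju g) // -(ju h).
Qed.

Lemma cokernel_epi x y z (f : hom x y) (p : hom y z) :
  is_cokernel f p -> epi p.
Proof.
case=> fi H w g h E.
have [|j [_ ju]] := H w (g ∘ p); first by rewrite -hcompA fi hcompf0.
by rewrite -(ju g) // -(ju h).
Qed.

Lemma is_kernelP x y z (f : hom y z) (i : hom x y) :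
  is_kernel f i <-> [/\ f ∘ i = 0, mono i
    & forall w (g : hom w y), f ∘ g = 0 -> exists h, g = i ∘ h].
Proof.
split=> [K | [fi mi H]].
  split; [exact: K.1 | exact: kernel_mono K |] => w g fg.
  by have [h [e _]] := K.2 w g fg; exists h.
split=> // w g /H [h ->]; exists h; split=> // h' E.
by apply: mi.
Qed.

Lemma is_cokernelP x y z (f : hom x y) (p : hom y z) :
  is_cokernel f p <-> [/\ p ∘ f = 0, epi p
    & forall w (g : hom y w), g ∘ f = 0 -> exists h, g = h ∘ p].
Proof.
split=> [K | [fi mi H]].
  split; [exact: K.1 | exact: cokernel_epi K |] => w g fg.
  by have [h [e _]] := K.2 w g fg; exists h.
split=> // w g /H [h ->]; exists h; split=> // h' E.
by apply: mi.
Qed.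

Lemma zero_objectP x : zero_object x <-> idm x = 0.
Proof.
split=> [/(_ x) [H _] | e y]; first exact: H.
split=> f; first by rewrite -(hcompf1 f) e hcompf0.
by rewrite -(hcomp1f f) e hcomp0f.
Qed.

Lemma epi_zero_object x y (p : hom x y) :
  epi p -> zero_object x -> zero_object y.
Proof.
move=> ep /zero_objectP x0; apply/zero_objectP; apply: ep.
by rewrite -[LHS]hcompf1 x0 !hcomp0f !hcompf0.
Qed.

Lemma cokernel_iso x y z z' (f : hom x y) (p : hom y z) (p' : hom y z') :
  is_cokernel f p -> is_cokernel f p' ->
  exists i : iso z z', p' = fwd i ∘ p.
Proof.
move=> /is_cokernelP[pf ep Hp] /is_cokernelP[p'f ep' Hp'].
have [i ei] := Hp _ _ p'f; have [j ej] := Hp' _ _ pf.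
have ji : j ∘ i = idm z by apply: ep; rewrite -hcompA -ei -ej hcomp1f.
have ij : i ∘ j = idm z' by apply: ep'; rewrite -hcompA -ej -ei hcomp1f.
by exists (Iso ji ij).
Qed.

Lemma cokernel_isor x y z z' (f : hom x y) (p : hom y z) (i : hom z z') :
  is_iso i -> is_cokernel f p -> is_cokernel f (i ∘ p).
Proof.
move=> ii /is_cokernelP[pf ep Hp]; apply/is_cokernelP; split.
- by rewrite -hcompA pf hcompf0.
- by apply: epi_comp => //; apply: is_iso_epi.
- move=> w g /Hp[h ->]; case: ii => j [ji _].
  by exists (h ∘ j); rewrite hcompA -(hcompA h) ji hcompf1.
Qed.

(** Precomposing with an epimorphism does not change a cokernel, so [a] is only asked to be epi.
    This carries a known presentation over to the bar presentation in [bar_aug_cokernel]. *)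
Lemma cokernel_of_isos x x' y y' z (f : hom x y) (p : hom y z)
    (a : hom x' x) (b : hom y y') (b' : hom y' y) (f' : hom x' y') :
  epi a -> b' ∘ b = idm y -> b ∘ b' = idm y' -> b' ∘ f' = f ∘ a ->
  is_cokernel f p -> is_cokernel f' (p ∘ b').
Proof.
move=> ea b'b bb' E /is_cokernelP[pf ep Hp]; apply/is_cokernelP; split.
- by rewrite -hcompA E hcompA pf hcomp0f.
- by apply: epi_comp => //; apply: is_iso_epi; exists b.
- move=> w g gf'; have [|h eh] := Hp _ (g ∘ b).
    apply: ea; rewrite hcomp0f -!hcompA -E (hcompA b) bb' hcomp1f; exact: gf'.
  by exists h; rewrite hcompA -eh -hcompA bb' hcompf1.
Qed.

Hypothesis abC : abelian C.

Lemma mono_epi_iso x y (f : hom x y) : mono f -> epi f -> is_iso f.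
Proof.
move=> mf ef; have [z [g /is_kernelP[gf _ H]]] := abelian_mono abC mf.
have g0 : g = 0 by move/epi0P: ef; apply.
have [|h E] := H y (idm y); first by rewrite g0 hcomp0f.
by apply: (@mono_split_iso _ _ _ f h).
Qed.

Lemma mono_kernel_cokernel x y z (i : hom x y) (p : hom y z) :
  mono i -> is_cokernel i p -> is_kernel p i.
Proof.
move=> mi /is_cokernelP[pi _ H]; have [w [g]] := abelian_mono abC mi.
move=> /is_kernelP[gi _ Hg]; apply/is_kernelP; split=> // v h ph.
have [l E] := H _ _ gi; apply: Hg.
by rewrite E -hcompA ph hcompf0.
Qed.

Lemma epi_cokernel_kernel x y z (i : hom x y) (p : hom y z) :
  epi p -> is_kernel p i -> is_cokernel i p.
Proof.
move=> mi /is_kernelP[pi _ H]; have [w [g]] := abelian_epi abC mi.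
move=> /is_cokernelP[gi _ Hg]; apply/is_cokernelP; split=> // v h ph.
have [l E] := H _ _ gi; apply: Hg.
by rewrite E hcompA ph hcomp0f.
Qed.

Lemma mono_short_exact x y (i : hom x y) :
  mono i -> exists z (p : hom y z), short_exact i p.
Proof.
move=> mi; have [z [p ci]] := abelian_cokernel abC i.
by exists z, p; split=> //; apply: mono_kernel_cokernel.
Qed.

Lemma epi_short_exact y z (p : hom y z) :
  epi p -> exists x (i : hom x y), short_exact i p.
Proof.
move=> mi; have [x [i ci]] := abelian_kernel abC p.
by exists x, i; split=> //; apply: epi_cokernel_kernel.
Qed.

(** The image [j] is the kernel of the cokernel of [f]. If [g] kills the induced map [q], the kernel
    [i] of [g] turns out to be split epi, so [g] is zero. *)
Lemma image_factorization x y (f : hom x y) :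
  exists z (q : hom x z) (j : hom z y), [/\ epi q, mono j & f = j ∘ q].
Proof.
have [c [p /is_cokernelP[pf ep Hp]]] := abelian_cokernel abC f.
have [z [j /is_kernelP[pj mj Hj]]] := abelian_kernel abC p.
have [q fE] := Hj _ _ pf; exists z, q, j; split=> //.
apply/epi0P => w g gq.
have [v [i /is_kernelP[gi mi Hi]]] := abelian_kernel abC g.
have [q' qE] := Hi _ _ gq.
(* The mono [j ∘ i] is the kernel of some [h], which kills [f]; hence [h] factors through [p] and
   kills [j], and so [j] factors through [j ∘ i]. *)
have [u [h /is_kernelP[hji _ Hh]]] := abelian_mono abC (mono_comp mj mi).
have [|h' hE] := Hp _ h; first by rewrite fE qE !hcompA -(hcompA h) hji hcomp0f.
have [|t jE] := Hh _ j; first by rewrite hE -hcompA pj hcompf0.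
have it : i ∘ t = idm z by apply: mj; rewrite hcompA -jE hcompf1.
by rewrite -(hcompf1 g) -it hcompA gi hcomp0f.
Qed.

Lemma simple_epi x s (f : hom x s) : simple s -> f <> 0 -> epi f.
Proof.
move=> [_ Hs] f0; have [z [q [j [eq mj fE]]]] := image_factorization f.
case: (Hs _ _ mj) => [z0|ij].
  by case: f0; have [j0 _] := z0 s; rewrite fE (j0 j) hcomp0f.
by rewrite fE; apply: epi_comp => //; exact: is_iso_epi.
Qed.

(** Schur's lemma: the kernel of [f] is zero or all of [s], and the latter contradicts [f <> 0]. *)
Lemma simple_epi_iso s t (f : hom s t) :
  simple s -> simple t -> f <> 0 -> is_iso f.
Proof.
move=> ss st f0; have ef := simple_epi st f0.
have [x [i [ki _]]] := epi_short_exact ef; have mi := kernel_mono ki.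
case: (ss.2 _ _ mi) => [x0 | ii].
  apply: mono_epi_iso ef; apply/mono0P => w g /(proj2 ki) [h [<- _]].
  by have [_ h0] := x0 w; rewrite (h0 h) hcompf0.
case: f0; apply: (is_iso_epi ii); rewrite hcomp0f; exact: ki.1.
Qed.

End LinearCategoryTheory.

Section BifunctorLinearity.
Variables (k : fieldType) (M N P : lincat k) (F : bifunctor M N P).

Lemma bmap0l (m m' : M) (n n' : N) (g : hom n n') :
  bmap F (0 : hom m m') g = 0.
Proof. by rewrite -(addNr 0) -[- 0]scaleN1r bmapPl scaleN1r addNr. Qed.

Lemma bmapBr (m m' : M) (n n' : N) (f : hom m m') (g g' : hom n n') :
  bmap F f (g - g') = bmap F f g - bmap F f g'.
Proof. by rewrite addrC -scaleN1r bmapPr scaleN1r addrC. Qed.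

End BifunctorLinearity.

(** * Finiteness from a projective generating family *)

Lemma ex_least (P : nat -> Prop) :
  (exists n, P n) -> exists2 n, P n & forall m, P m -> (n <= m)%N.
Proof.
move=> exP; have exb : exists n, `[< P n >] by case: exP => n /asboolP; exists n.
exists (ex_minn exb); first by case: ex_minnP => m /asboolP.
by case: ex_minnP => m _ mm n /asboolP; apply: mm.
Qed.

Section FiniteLength.
Variables (k : fieldType) (C : lincat k).
Implicit Types x y z s t : C.
Hypothesis abC : abelian C.

Lemma projective_retract x y (i : hom x y) (r : hom y x) :
  r ∘ i = idm x -> projective y -> projective x.
Proof.
move=> ri py u v e f /(py _ _ e (f ∘ r)) [g eg].
by exists (g ∘ i); rewrite hcompA eg -hcompA ri hcompf1.
Qed.

(** Composition under a name of its own, so that it can carry a linear structure and be fed to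
    [linfun]. *)
Definition postcomp x y z (p : hom y z) (f : hom x y) : hom x z := p ∘ f.

Fact postcomp_is_linear x y z (p : hom y z) : linear (@postcomp x y z p).
Proof. by move=> a f g; exact: hcompPr. Qed.

HB.instance Definition _ x y z (p : hom y z) :=
  GRing.isLinear.Build k (hom x y) (hom x z) _
    (@postcomp x y z p) (@postcomp_is_linear x y z p).

(** Rank and nullity for composition with [p]: projectivity of [P] makes it surjective, and its
    kernel is the image of composition with [i], which is injective. *)
Lemma dim_hom_short_exact (P : C) x y z (i : hom x y) (p : hom y z) :
  projective P -> short_exact i p ->
  \dim {: hom P y} = (\dim {: hom P x} + \dim {: hom P z})%N.
Proof.
move=> pP [ki ci]; pose fi := linfun (@postcomp P x y i).
pose fp := linfun (@postcomp P y z p).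
have mi := kernel_mono ki; have ep := cokernel_epi ci.
have ker0 : lker fi = 0%VS.
  apply/eqP; rewrite -subv0; apply/subvP => f.
  rewrite memv_ker lfunE /= /postcomp memv0 => /eqP if0.
  by apply/eqP; apply: mi; rewrite if0 hcompf0.
have imp : limg fp = fullv.
  apply/eqP; rewrite eqEsubv subvf /=; apply/subvP => f _.
  have [g <-] := pP _ _ p f ep.
  have -> : p ∘ g = fp g by rewrite lfunE.
  by apply: memv_img; apply: memvf.
have kerp : lker fp = limg fi.
  apply/vspaceP => f; apply/idP/idP; rewrite memv_ker lfunE /= /postcomp.
    move/eqP/(proj2 ki) => [h [<- _]].
    have -> : i ∘ h = fi h by rewrite lfunE.
    by apply: memv_img; apply: memvf.
  case/memv_imgP => h _ ->; rewrite lfunE /= /postcomp hcompA.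
  by rewrite (proj1 ki) hcomp0f.
rewrite -(limg_ker_dim fp fullv) imp capfv kerp; congr (_ + _)%N.
by apply: limg_dim_eq; rewrite ker0 capv0.
Qed.

Variables (n : nat) (P : 'I_n -> C).
Hypothesis projP : forall i, projective (P i).
Hypothesis genP : forall x, ~ zero_object x ->
  exists i (f : hom (P i) x), f <> 0.

(* Exactness of [hom (P i) _] makes this an additive invariant that vanishes
   only on zero objects; it replaces the length in all induction arguments. *)
Definition size_obj x : nat := (\sum_i \dim {: hom (P i) x})%N.

Lemma size_obj_short_exact x y z (i : hom x y) (p : hom y z) :
  short_exact i p -> size_obj y = (size_obj x + size_obj z)%N.
Proof.
move=> ex; rewrite /size_obj -big_split /=; apply: eq_bigr => j _.
exact: dim_hom_short_exact ex.
Qed.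

Lemma size_obj_eq0 x : size_obj x = 0%N -> zero_object x.
Proof.
move=> /eqP; rewrite sum_nat_eq0 => /forallP s0; apply: contrapT => /genP.
case=> i [f]; apply; have := s0 i; rewrite implyTb dimv_eq0 => /eqP h0.
by apply/eqP; rewrite -memv0 -h0 memvf.
Qed.

Lemma size_obj_zero x : zero_object x -> size_obj x = 0%N.
Proof.
move=> x0; apply/eqP; rewrite sum_nat_eq0; apply/forallP => i.
rewrite implyTb dimv_eq0 -subv0; apply/subvP => f _.
by rewrite memv0; have [_ h] := x0 (P i); rewrite (h f).
Qed.

Lemma size_obj_mono x y (i : hom x y) : mono i ->
  (size_obj x <= size_obj y)%N /\ (size_obj x = size_obj y -> is_iso i).
Proof.
move=> mi; have [z [p ex]] := mono_short_exact abC mi.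
rewrite (size_obj_short_exact ex); split; first exact: leq_addr.
move=> /eqP; rewrite -[X in X == _]addn0 eqn_add2l eq_sym => /eqP /size_obj_eq0 z0.
apply: (mono_epi_iso abC mi); apply/epi0P => w g gi.
have [h [<- _]] := ex.2.2 _ _ gi.
by have [h0 _] := z0 w; rewrite (h0 h) hcomp0f.
Qed.

Lemma size_obj_epi x y (p : hom x y) : epi p ->
  (size_obj y <= size_obj x)%N /\ (size_obj x = size_obj y -> is_iso p).
Proof.
move=> ep; have [z [i ex]] := epi_short_exact abC ep.
rewrite (size_obj_short_exact ex); split; first exact: leq_addl.
move=> /eqP; rewrite -[X in _ == X]add0n eqn_add2r => /eqP /size_obj_eq0 z0.
apply: (mono_epi_iso abC) ep; apply/mono0P => w g gi.
have [h [<- _]] := ex.1.2 _ _ gi.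
by have [_ h0] := z0 w; rewrite (h0 h) hcompf0.
Qed.

(* A nonzero quotient of minimal size is simple. *)
Lemma simple_quotient x : ~ zero_object x ->
  exists s (p : hom x s), simple s /\ epi p.
Proof.
move=> x0; pose Q m := exists s (p : hom x s),
  [/\ ~ zero_object s, epi p & size_obj s = m].
have [|m [s [p [s0 ep sm]]] mm] := @ex_least Q.
  by exists (size_obj x), x, (idm x); split=> // ? ? ?; rewrite !hcompf1.
exists s, p; split=> //; split=> // y i mi.
have [y0|y0] := pselect (zero_object y); [by left | right].
have [z [q ex]] := mono_short_exact abC mi; have eq := cokernel_epi ex.2.
have [z0|z0] := pselect (zero_object z).
  apply: (size_obj_mono mi).2.
  by rewrite (size_obj_short_exact ex) (size_obj_zero z0) addn0.
have : (m <= size_obj z)%N.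
  by apply: mm; exists z, (q ∘ p); split=> //; apply: epi_comp.
rewrite -sm (size_obj_short_exact ex) -[leqRHS]add0n leq_add2r leqn0.
by move/eqP/size_obj_eq0.
Qed.

(** Induction on size: splitting off a simple quotient leaves a strictly smaller kernel, because a
    simple object has nonzero size. *)
Lemma all_finite_length x : finite_length x.
Proof.
have [m] := ubnP (size_obj x); elim: m x => // m IH x lexm.
have [x0|x0] := pselect (zero_object x); first exact: finite_length_zero.
have [s [p [ss ep]]] := simple_quotient x0.
have [y [i ex]] := epi_short_exact abC ep.
apply: (finite_length_ext ex _ ss); apply: IH.
move: lexm; rewrite (size_obj_short_exact ex) ltnS; apply: leq_trans.
rewrite -addn1 leq_add2l lt0n; apply: contraPneq ss.1.
by move/size_obj_eq0 => s0; apply.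
Qed.

(** Induction along a composition series with top factor [t]: a map to a simple that vanishes on the
    subobject factors through [t], and Schur's lemma applies; otherwise its restriction to the
    subobject is nonzero. *)
Lemma simple_quotients_finite x : finite_length x ->
  exists (I : finType) (S : I -> C), forall s (p : hom x s), simple s ->
    p <> 0 -> exists i, inhabited (iso s (S i)).
Proof.
elim=> {x} [x x0 | x y t i p ex _ [I [S HS]] st].
  exists void, (fun v : void => match v with end) => s p _ [].
  by have [h _] := x0 s; rewrite (h p).
exists (option I), (fun o => if o is Some j then S j else t) => s q ss q0.
have [qi|qi] := pselect (q ∘ i = 0).
  have [h [qE _]] := ex.2.2 _ _ qi; exists None; have [|j _] := @is_iso_iso _ _ _ h.
    by apply: simple_epi_iso => // h0; apply: q0; rewrite -qE h0 hcomp0f.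
  by constructor; exact: iso_inv.
by have [j hj] := HS _ _ ss qi; exists (Some j).
Qed.

(** Every simple receives a nonzero map from some [P i], so it is among the finitely many simple
    quotients of the generators. *)
Lemma finitely_many_simples :
  exists (m : nat) (S : 'I_m -> C),
    forall x, simple x -> exists i, inhabited (iso x (S i)).
Proof.
have HP i : exists J : {I : finType & I -> C},
    forall s (p : hom (P i) s), simple s -> p <> 0 ->
    exists j, inhabited (iso s (tagged J j)).
  have [I [S HS]] := simple_quotients_finite (all_finite_length (P i)).
  by exists (existT _ I S).
have [J HJ] := choice HP.
pose I : finType := {i : 'I_n & tag (J i)}.
exists #|I|, (fun j => tagged (J (tag (enum_val j))) (tagged (enum_val j))).
move=> x sx; have [i [f f0]] := genP sx.1; have [j hj] := HJ _ _ _ sx f0.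
by exists (enum_rank (Tagged (fun i => tag (J i)) j : I)); rewrite enum_rankK.
Qed.

(** Take a projective [R] of least size that maps onto [x]. If [p ∘ g] is epi, [p] lifts through it
    to some [t]. The image of [g ∘ t], once chosen of least size, is a projective retract of [R]
    that still maps onto [x]; so it is all of [R], and [g] is epi. *)
Lemma projective_cover_exists x (Q : C) (q : hom Q x) :
  projective Q -> epi q -> exists R (p : hom R x), projective_cover p.
Proof.
move=> pQ eq; pose W m := exists R (p : hom R x),
  [/\ projective R, epi p & size_obj R = m].
have [|m [R [p [pR ep <-]]] minR] := @ex_least W.
  by exists (size_obj Q), Q, q.
exists R, p; split=> // y g epg.
have [t0 pt0] := pR _ _ (p ∘ g) p epg.
pose V l := exists (t : hom R y) z (a : hom R z) (j : hom z R),
  [/\ p ∘ g ∘ t = p, g ∘ t = j ∘ a, epi a, mono j & size_obj z = l].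
have [|l [t [z [a [j [pgt gt ea mj <-]]]]] minz] := @ex_least V.
  have [z [a [j [ea mj E]]]] := image_factorization abC (g ∘ t0).
  by exists (size_obj z), t0, z, a, j.
have [z' [b [i [eb mi aj]]]] := image_factorization abC (a ∘ j).
(* The image of [(g ∘ t) ∘ (g ∘ t)] is [z'], so minimality of [z] makes
   [a ∘ j] invertible and [z] a retract of [R]. *)
have sz : (size_obj z <= size_obj z')%N.
  apply: minz; exists (t ∘ (g ∘ t)), z', (b ∘ a), (j ∘ i); split=> //.
  - by rewrite !hcompA pgt pgt.
  - by rewrite (hcompA g) gt -!hcompA (hcompA a) aj !hcompA.
  - exact: epi_comp.
  - exact: mono_comp.
have [szi ii] := size_obj_mono mi; have [szb ib] := size_obj_epi eb.
have e : size_obj z' = size_obj z by apply/eqP; rewrite eqn_leq szi sz.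
have [c [cK cK']] : is_iso (a ∘ j).
  by rewrite aj; apply: is_iso_comp; [apply: ii | apply: ib].
have pz : projective z.
  by apply: (@projective_retract _ _ j (c ∘ a)) => //; rewrite -hcompA.
have epj : epi (p ∘ j).
  by apply: (@epi_cancel _ _ _ _ _ a); rewrite -hcompA -gt hcompA pgt.
have szR : (size_obj R <= size_obj z)%N by apply: minR; exists z, (p ∘ j).
have [szj ij] := size_obj_mono mj.
have ej : epi j.
  by apply/is_iso_epi/ij/eqP; rewrite eqn_leq szj.
by apply: (@epi_cancel _ _ _ _ _ t); rewrite gt; apply: epi_comp.
Qed.

Lemma finite_abelian_intro :
  (forall x, exists Q (q : hom Q x), projective Q /\ epi q) ->
  finite_abelian C.
Proof.
move=> enough; split=> //.
- exact: all_finite_length.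
- move=> x; have [Q [q [pQ eq]]] := enough x.
  exact: projective_cover_exists pQ eq.
- exact: finitely_many_simples.
Qed.

End FiniteLength.

(** The generators are covers of the simples: the top composition factor of a nonzero object is
    isomorphic to some [S i], and the cover of [S i] lifts along the quotient map. *)
Lemma projective_generators (k : fieldType) (C : lincat k) :
  finite_abelian C ->
  exists (n : nat) (P : 'I_n -> C), (forall i, projective (P i)) /\
    forall x : C, ~ zero_object x -> exists i (f : hom (P i) x), f <> 0.
Proof.
case=> abC flC coverC [n [S HS]].
have HP i : exists J : {P : C & hom P (S i)}, projective (tag J) /\ epi (tagged J).
  by have [P [p [pP ep _]]] := coverC (S i); exists (existT _ P p).
pose J i := projT1 (cid (HP i)); have HJ i := projT2 (cid (HP i)).
exists n, (fun i => tag (J i)); split=> [i|x x0]; first by have [] := HJ i.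
have [s [q [ss eq]]] : exists s (q : hom x s), simple s /\ epi q.
  case: (flC x) x0 => // {x} x y s i q ex _ ss _.
  by exists s, q; split=> //; apply: cokernel_epi ex.2.
have [i [u]] := HS s ss.
have [pJ eJ] : projective (tag (J i)) /\ epi (tagged (J i)) := HJ i.
have [f fE] := pJ _ _ q (bwd u ∘ tagged (J i)) eq.
exists i, f => f0; apply: ss.1; move: fE; rewrite f0 hcompf0 => /esym u0.
apply: (@epi_zero_object _ _ (S i) s (bwd u)); first exact: iso_epi (iso_inv u).
apply/zero_objectP/eJ/(is_iso_mono (iso_is_iso (iso_inv u))).
by rewrite hcomp1f hcomp0f hcompf0.
Qed.

(** * Module objects *)

Section ModuleCategory.
Variables (k : fieldType) (C : monoidal_category k) (A : algebra C).
Variable M : right_action C.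
Implicit Types x y z : modules A M.

Definition forget x y (f : hom x y) : hom (mobj x) (mobj y) :=
  vsval (f : subvs_of (module_hom x y)).

Definition module_mor x y (f : hom (mobj x) (mobj y))
    (fP : mact y ∘ (f ◁₁ idm (A : C)) = f ∘ mact x) : hom x y :=
  Subvs (proj2 (mem_module_hom f) fP).

Lemma forgetP x y (f : hom x y) :
  mact y ∘ (forget f ◁₁ idm (A : C)) = forget f ∘ mact x.
Proof. by apply/mem_module_hom; apply: valP. Qed.

Lemma forget_inj x y : injective (@forget x y).
Proof. by move=> f g e; apply: val_inj. Qed.

Lemma forget_comp x y z (g : hom y z) (f : hom x y) :
  forget (g ∘ f) = forget g ∘ forget f.
Proof. by []. Qed.

Lemma forget_id x : forget (idm x) = idm (mobj x).
Proof. by []. Qed.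

Lemma forget0 x y : forget (0 : hom x y) = 0.
Proof. exact: (linear0 (vsval : subvs_of (module_hom x y) -> _)). Qed.

Lemma forgetB x y (f g : hom x y) : forget (f - g) = forget f - forget g.
Proof. exact: (linearB (vsval : subvs_of (module_hom x y) -> _)). Qed.

Lemma mono_forget x y (f : hom x y) : mono (forget f) -> mono f.
Proof.
move=> mf z g h e; apply: forget_inj; apply: mf.
by rewrite -!forget_comp e.
Qed.

Lemma epi_forget x y (f : hom x y) : epi (forget f) -> epi f.
Proof.
move=> mf z g h e; apply: forget_inj; apply: mf.
by rewrite -!forget_comp e.
Qed.

Lemma is_iso_forget x y (f : hom x y) : is_iso f <-> is_iso (forget f).
Proof.
split=> [[g [gf fg]] | [g [gf fg]]].
  by exists (forget g); rewrite -!forget_comp gf fg.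
have gP : mact x ∘ (g ◁₁ idm (A : C)) = g ∘ mact y.
  apply: (is_iso_mono (f := forget f)); first by exists g.
  by rewrite !hcompA fg hcomp1f -forgetP -hcompA -bfixrM fg bmap1 hcompf1.
by exists (module_mor gP); split; apply: forget_inj.
Qed.

(** Acting with the unit object is faithful by [runit]; after it the claim follows from the pentagon
    and the triangles. *)
Lemma runit_act (m : M) (c : C) :
  (idm m ◁₁ trunit c) ∘ rassoc m c tunit = runit (m ◁ c).
Proof.
suff e : ((idm m ◁₁ trunit c) ∘ rassoc m c tunit) ◁₁ idm tunit
         = runit (m ◁ c) ◁₁ idm (tunit : C).
  by apply: (@iso_epi _ _ _ (runit _)); rewrite -!runitN e.
rewrite bfixrM -[RHS]rtriangle.
apply: (@iso_mono _ _ _ (rassoc m c tunit)).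
rewrite !hcompA rassocN -(ttriangle c) bfixlM.
rewrite -!hcompA (hcompA (idm m ◁₁ tassoc c _ _)) -rpentagon.
by rewrite !hcompA -rassocN bmap1.
Qed.

Lemma kernel_of_forget x y z (f : hom y z) (i : hom x y) :
  is_kernel (forget f) (forget i) -> is_kernel f i.
Proof.
move=> /is_kernelP[fi mi H]; apply/is_kernelP; split.
- by apply: forget_inj; rewrite forget0 forget_comp.
- exact: mono_forget.
- move=> w g fg; have [|h hE] := H _ (forget g).
    by rewrite -forget_comp fg forget0.
  have hP : mact x ∘ (h ◁₁ idm (A : C)) = h ∘ mact w.
    by apply: mi; rewrite !hcompA -hE -!forgetP -hcompA -bfixrM hE.
  by exists (module_mor hP); apply: forget_inj.
Qed.

(** * Cokernels of module objects *)

Section RightExact.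
Hypothesis rexA : right_exact (bfixr (ract M) (A : C)).

Lemma cokernel_of_forget x y z (f : hom x y) (p : hom y z) :
  is_cokernel (forget f) (forget p) -> is_cokernel f p.
Proof.
move=> cp; have /is_cokernelP[fi mi H] := cp; apply/is_cokernelP; split.
- by apply: forget_inj; rewrite forget0 forget_comp.
- exact: epi_forget.
- move=> w g fg; have [|h hE] := H _ (forget g).
    by rewrite -forget_comp fg forget0.
  have hP : mact w ∘ (h ◁₁ idm (A : C)) = h ∘ mact z.
    apply: (cokernel_epi (rexA cp)) => /=.
    by rewrite -!hcompA -bfixrM -hE forgetP hE -hcompA -forgetP.
  by exists (module_mor hP); apply: forget_inj.
Qed.

(** As [_ ◁ A] preserves the cokernel, the action of [y] descends to it. Associativity is tested
    after the epimorphism got from [p] by acting twice with [A], unitality after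
    [p ◁₁ idm tunit]. *)
Lemma module_cokernel x y (f : hom x y) :
  (exists (z : M) (p : hom (mobj y) z), is_cokernel (forget f) p) ->
  exists z (p : hom y z), is_cokernel (forget f) (forget p).
Proof.
move=> [z [p cp]]; have pf := cp.1.
have cp1 : is_cokernel (forget f ◁₁ idm (A : C)) (p ◁₁ idm (A : C)) := rexA cp.
have cf1 : is_cokernel _ ((p ◁₁ idm (A : C)) ◁₁ idm (A : C)) := rexA cp1.
have [|a [aE _]] := cp1.2 _ (p ∘ mact y).
  by rewrite -hcompA forgetP hcompA pf hcomp0f.
have aA : a ∘ (a ◁₁ idm (A : C)) = a ∘ (idm z ◁₁ amul A) ∘ rassoc z A A.
  apply: (cokernel_epi cf1).
  rewrite -!hcompA -bfixrM aE rassocN bfixrM !hcompA aE -hcompA mactA.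
  rewrite !hcompA; congr (_ ∘ _).
  rewrite -(hcompA a) -bmapM bmap1 hcomp1f hcompf1.
  by rewrite -aE -hcompA -bmapM hcomp1f hcompf1.
have a1 : a ∘ (idm z ◁₁ aone A) = runit z.
  (* [runit] identifies this map with [p], which is epi. *)
  have ep : epi (p ◁₁ idm (tunit : C)).
    rewrite -[_ ◁₁ _]hcomp1f -(fwdK (runit z)) -hcompA runitN.
    apply: epi_comp; first exact: iso_epi (iso_inv (runit z)).
    by apply: epi_comp; [exact: cokernel_epi cp | exact: iso_epi].
  apply: ep; rewrite runitN -mact1 -hcompA -bmapM hcomp1f hcompf1 hcompA.
  by rewrite -aE -hcompA -bmapM hcomp1f hcompf1.
pose z' : modules A M := ModuleObject aA a1.
by exists z', (@module_mor y z' p aE).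
Qed.

Lemma forget_cokernel x y z (f : hom x y) (p : hom y z) :
  (exists (z : M) (p : hom (mobj y) z), is_cokernel (forget f) p) ->
  is_cokernel f p -> is_cokernel (forget f) (forget p).
Proof.
move=> /module_cokernel [z' [p' cp']] cp.
have [i ->] := cokernel_iso (cokernel_of_forget cp') cp.
by apply: cokernel_isor cp'; apply/is_iso_forget/iso_is_iso.
Qed.

End RightExact.

(** * Action on modules and free modules *)

Definition act_mact (m : M) (c : C) (a : hom (c ⊗ A) c) :
    hom ((m ◁ c) ◁ A) (m ◁ c) :=
  (idm m ◁₁ a) ∘ rassoc m c A.

Fact act_mactA (m : M) (c : C) (a : hom (c ⊗ A) c) :
    a ∘ (a ⊗₁ idm (A : C)) = a ∘ (idm c ⊗₁ amul A) ∘ tassoc c A A ->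
  act_mact m a ∘ (act_mact m a ◁₁ idm (A : C))
  = act_mact m a ∘ (idm (m ◁ c) ◁₁ amul A) ∘ rassoc (m ◁ c) A A.
Proof.
move=> aA; rewrite /act_mact bfixrM hcompA -(hcompA _ (rassoc _ _ _)) rassocN.
rewrite hcompA -bfixlM aA !bfixlM -!hcompA (hcompA (_ ◁₁ fwd (tassoc _ _ _))).
rewrite -rpentagon -bmap1 !hcompA -(hcompA _ _ (bmap _ _ (amul A))).
by rewrite rassocN !hcompA.
Qed.

Fact act_mact1 (m : M) (c : C) (a : hom (c ⊗ A) c) :
  a ∘ (idm c ⊗₁ aone A) = trunit c ->
  act_mact m a ∘ (idm (m ◁ c) ◁₁ aone A) = runit (m ◁ c).
Proof.
move=> a1; rewrite /act_mact -bmap1 -hcompA rassocN hcompA -bfixlM a1.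
exact: runit_act.
Qed.

Definition act_module (m : M) (x : modules A (regular_action C)) :
    modules A M :=
  @ModuleObject k C A M (m ◁ mobj x) (act_mact m (mact x))
    (act_mactA m (mactA x)) (act_mact1 m (mact1 x)).

Definition regular_module : modules A (regular_action C) :=
  @ModuleObject k C A (regular_action C) A (amul A) (amulA A) (amul1r A).

Definition free_module (m : M) : modules A M := act_module m regular_module.

(** The transpose of [f] under the adjunction between free modules and the forgetful functor, whose
    unit is [free_unit]. *)
Definition free_mor (m : M) x (f : hom m (mobj x)) : hom (free_module m) x.
apply: (@module_mor (free_module m) x (mact x ∘ (f ◁₁ idm (A : C)))).
rewrite /= /act_mact bfixrM hcompA mactA -!hcompA rassocN.
rewrite bmap1 (hcompA (f ◁₁ _)) -bmapM (hcompA (_ ◁₁ amul A)) -bmapM.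
by rewrite !hcompf1 !hcomp1f.
Defined.

Definition free_unit (m : M) : hom m (m ◁ (A : C)) :=
  (idm m ◁₁ aone A) ∘ bwd (runit m).

Lemma free_morK (m : M) x (f : hom m (mobj x)) :
  forget (free_mor f) ∘ free_unit m = f.
Proof.
rewrite /free_unit /= -hcompA (hcompA (f ◁₁ _)) -bmapM hcomp1f hcompf1.
rewrite -[f in f ◁₁ _]hcomp1f -[aone A]hcompf1 bmapM !hcompA mact1 runitN.
by rewrite -hcompA bwdK hcompf1.
Qed.

Lemma free_mor_unique (m : M) x (g : hom (free_module m) x) :
  g = free_mor (forget g ∘ free_unit m).
Proof.
apply: forget_inj => /=; rewrite bfixrM hcompA (forgetP g) /= /act_mact -hcompA.
rewrite [X in _ ∘ X](_ : _ = idm _) ?hcompf1 //.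
rewrite /free_unit bfixrM hcompA -(hcompA _ (rassoc _ _ _)) rassocN.
rewrite hcompA -bfixlM amul1l rtriangle -bfixrM bwdK; exact: bmap1.
Qed.

(** A left adjoint of a functor that preserves epimorphisms preserves projectives. *)
Lemma free_projective (m : M) :
  (forall x y (f : hom x y), epi f -> epi (forget f)) ->
  projective m -> projective (free_module m).
Proof.
move=> epiF pm x y e f /epiF /(pm _ _ _ (forget f ∘ free_unit m)) [g eg].
exists (free_mor g); rewrite (free_mor_unique f) -eg; apply: forget_inj => /=.
by rewrite hcompA -forgetP -hcompA -bfixrM.
Qed.

(** Its composite with the unit of [A] is already the isomorphism [runit]. *)
Lemma mact_epi x : epi (mact x).
Proof.
apply: (@epi_cancel _ _ _ _ _ (idm _ ◁₁ aone A)); rewrite mact1; exact: iso_epi.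
Qed.

Lemma free_mor_epi (m : M) x (f : hom m (mobj x)) :
  right_exact (bfixr (ract M) (A : C)) -> abelian M ->
  epi f -> epi (free_mor f).
Proof.
move=> rexA abM ef; apply: epi_forget => /=; apply: epi_comp (@mact_epi _) _.
have [y [i [_ ci]]] := epi_short_exact abM ef.
exact: (cokernel_epi (rexA _ _ _ _ _ ci)).
Qed.

(** * The abelian category of module objects *)

Section Abelian.
Hypothesis abM : abelian M.
Hypothesis exA : exact (bfixr (ract M) (A : C)).
Let rexA := exA.2.

Lemma module_kernel y z (f : hom y z) :
  exists x (i : hom x y), is_kernel (forget f) (forget i).
Proof.
have [x [i ki]] := abelian_kernel abM (forget f).
have mi := kernel_mono ki; have fi := ki.1.
have ki1 : is_kernel (forget f ◁₁ idm (A : C)) (i ◁₁ idm (A : C)) :=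
  exA.1 _ _ _ _ _ ki.
have [|a [aE _]] := ki.2 _ (mact y ∘ (i ◁₁ idm (A : C))).
  by rewrite hcompA -forgetP -hcompA ki1.1 hcompf0.
have aA : a ∘ (a ◁₁ idm (A : C)) = a ∘ (idm x ◁₁ amul A) ∘ rassoc x A A.
  apply: mi; rewrite !hcompA aE -hcompA -bfixrM aE bfixrM hcompA mactA.
  rewrite -!hcompA rassocN bmap1.
  by rewrite !(hcompA (_ ◁₁ _)) -!bmapM !hcomp1f !hcompf1.
have a1 : a ∘ (idm x ◁₁ aone A) = runit x.
  apply: mi; rewrite hcompA aE -hcompA -bmapM hcomp1f hcompf1.
  by rewrite -runitN -mact1 -hcompA -bmapM hcomp1f hcompf1.
pose x' : modules A M := ModuleObject aA a1.
by exists x', (@module_mor x' y i (esym aE)).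
Qed.

Lemma forget_mono x y (f : hom x y) : mono f -> mono (forget f).
Proof.
move=> mf; have [z [i ki]] := module_kernel f.
have i0 : i = 0.
  by apply: mf; rewrite hcompf0; apply: forget_inj; rewrite forget0; exact: ki.1.
apply/mono0P => w g /(proj2 ki) [h [<- _]].
by rewrite i0 forget0 hcomp0f.
Qed.

Lemma forget_epi x y (f : hom x y) : epi f -> epi (forget f).
Proof.
move=> mf; have [z [i ki]] := module_cokernel rexA (abelian_cokernel abM (forget f)).
have i0 : i = 0.
  by apply: mf; rewrite hcomp0f; apply: forget_inj; rewrite forget0; exact: ki.1.
apply/epi0P => w g /(proj2 ki) [h [<- _]].
by rewrite i0 forget0 hcompf0.
Qed.

Lemma module_zero : exists x : modules A M, zero_object x.
Proof.
have [z z0] := abelian_zero abM.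
have h0 (u : M) (f g : hom u z) : f = g.
  by have [_ h] := z0 u; rewrite (h f) (h g).
pose z' : modules A M := ModuleObject
  (h0 _ (0 ∘ (0 ◁₁ idm (A : C))) (0 ∘ (idm z ◁₁ amul A) ∘ rassoc z A A))
  (h0 _ (0 ∘ (idm z ◁₁ aone A)) (fwd (runit z))).
by exists z'; apply/zero_objectP; apply: forget_inj; apply: h0.
Qed.

Lemma module_biproduct x y : exists z, biproduct x y z.
Proof.
have [z [i1 [i2 [p1 [p2 [p11 p22 p12 p21 pz]]]]]] :=
  abelian_biproduct abM (mobj x) (mobj y).
pose a : hom (z ◁ A) z := i1 ∘ mact x ∘ (p1 ◁₁ idm (A : C))
                          + i2 ∘ mact y ∘ (p2 ◁₁ idm (A : C)).
have ap1 : p1 ∘ a = mact x ∘ (p1 ◁₁ idm (A : C)).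
  by rewrite /a hcompDr !hcompA p11 p12 hcomp1f !hcomp0f addr0.
have ap2 : p2 ∘ a = mact y ∘ (p2 ◁₁ idm (A : C)).
  by rewrite /a hcompDr !hcompA p22 p21 hcomp1f !hcomp0f add0r.
(* The projections are jointly monic, so equations between maps into [z] are checked after [p1] and
   [p2]. *)
have pI (u : M) (f g : hom u z) : p1 ∘ f = p1 ∘ g -> p2 ∘ f = p2 ∘ g -> f = g.
  by move=> e1 e2; rewrite -[f]hcomp1f -[g]hcomp1f -pz !hcompDl -!hcompA e1 e2.
have aAp (t : modules A M) (p : hom z (mobj t)) :
    p ∘ a = mact t ∘ (p ◁₁ idm (A : C)) ->
    p ∘ (a ∘ (a ◁₁ idm (A : C))) = p ∘ (a ∘ (idm z ◁₁ amul A) ∘ rassoc z A A).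
  move=> pa; rewrite !hcompA pa -hcompA -bfixrM pa bfixrM hcompA mactA.
  rewrite -!hcompA rassocN bmap1.
  by rewrite !(hcompA (_ ◁₁ _)) -!bmapM !hcomp1f !hcompf1.
have a1p (t : modules A M) (p : hom z (mobj t)) :
    p ∘ a = mact t ∘ (p ◁₁ idm (A : C)) ->
    p ∘ (a ∘ (idm z ◁₁ aone A)) = p ∘ runit z.
  move=> pa; rewrite hcompA pa -hcompA -bmapM hcomp1f hcompf1.
  by rewrite -runitN -mact1 -hcompA -bmapM hcomp1f hcompf1.
pose z' : modules A M := ModuleObject
  (pI _ _ _ (aAp _ _ ap1) (aAp _ _ ap2)) (pI _ _ _ (a1p _ _ ap1) (a1p _ _ ap2)).
have i1P : mact z' ∘ (i1 ◁₁ idm (A : C)) = i1 ∘ mact x.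
  apply: (pI _) => /=; rewrite !hcompA ?ap1 ?ap2 -hcompA -bfixrM ?p11 ?p21.
    by rewrite bmap1 hcompf1 hcomp1f.
  by rewrite bmap0l hcompf0 hcomp0f.
have i2P : mact z' ∘ (i2 ◁₁ idm (A : C)) = i2 ∘ mact y.
  apply: (pI _) => /=; rewrite !hcompA ?ap1 ?ap2 -hcompA -bfixrM ?p12 ?p22.
    by rewrite bmap0l hcompf0 hcomp0f.
  by rewrite bmap1 hcompf1 hcomp1f.
exists z', (module_mor i1P), (module_mor i2P).
exists (@module_mor z' x p1 (esym ap1)), (@module_mor z' y p2 (esym ap2)).
split; apply: forget_inj; rewrite ?forget0 //.
Qed.

Lemma modules_abelian : abelian (modules A M).
Proof.
split.
- exact: module_zero.
- exact: module_biproduct.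
- move=> y z f; have [x [i ki]] := module_kernel f.
  by exists x, i; apply: kernel_of_forget.
- move=> x y f; have [z [p cp]] :=
    module_cokernel rexA (abelian_cokernel abM (forget f)).
  by exists z, p; apply: cokernel_of_forget.
- move=> x y i /forget_mono mi.
  have [z [p cp]] := module_cokernel rexA (abelian_cokernel abM (forget i)).
  by exists z, p; apply/kernel_of_forget/mono_kernel_cokernel.
- move=> y z p /forget_epi mp; have [x [i ki]] := module_kernel p.
  by exists x, i; apply/cokernel_of_forget/epi_cokernel_kernel.
Qed.

End Abelian.

(** Free modules on projective generators of [M] are projective generators, since a nonzero map has
    a nonzero transpose; the free module on a projective cover of the underlying object maps onto
    [x]. *)
Lemma modules_finite_abelian :
  finite_abelian M -> exact (bfixr (ract M) (A : C)) ->
  finite_abelian (modules A M).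
Proof.
move=> faM exA; have abM := fa_abelian faM.
have [n [P [projP genP]]] := projective_generators faM.
have projF m := @free_projective m (fun x y f => @forget_epi abM exA x y f).
apply: (@finite_abelian_intro _ _ (modules_abelian abM exA) n
  (fun i => free_module (P i))) => [i | x x0 | x].
- exact/projF/projP.
- have [|i [f f0]] := genP (mobj x).
    move=> /zero_objectP x0'; apply: x0; apply/zero_objectP.
    by apply: forget_inj; rewrite forget0.
  exists i, (free_mor f) => F0; apply: f0.
  by rewrite -(free_morK f) F0 forget0 hcomp0f.
- have [P' [p [pP' ep _]]] := fa_cover faM (mobj x).
  exists (free_module P'), (free_mor p); split; first exact: projF.
  exact: free_mor_epi exA.2 abM ep.
Qed.

End ModuleCategory.

(** * The balanced functor [(m, x) |-> m ◁ x] *)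

Section Duality.
Variables (k : fieldType) (C : monoidal_category k).

(** This is the duality identity of [a] tensored on the left with [x] and rebracketed by coherence;
    it serves as a triangle identity for [_ ⊗ a] and [_ ⊗ d]. *)
Lemma left_dual_zigzag (a d : C) (ev : hom (d ⊗ a) tunit)
    (coev : hom tunit (a ⊗ d)) (x : C) :
  trunit a ∘ (idm a ⊗₁ ev) ∘ tassoc a d a ∘ (coev ⊗₁ idm a)
    ∘ bwd (tlunit a) = idm a ->
  trunit (x ⊗ a) ∘ (idm (x ⊗ a) ⊗₁ ev) ∘ tassoc (x ⊗ a) d a
    ∘ ((bwd (tassoc x a d) ∘ (idm x ⊗₁ coev) ∘ bwd (trunit x)) ⊗₁ idm a)
  = idm (x ⊗ a).
Proof.
move=> zz.
have e1 : tassoc x tunit a ∘ (bwd (trunit x) ⊗₁ idm a) = idm x ⊗₁ bwd (tlunit a).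
  apply: (@iso_mono _ _ _ (fmap_iso (bfixl (tensor C) x) (tlunit a))) => /=.
  by rewrite -bmapM bwdK hcompA ttriangle -bmapM bwdK !hcomp1f.
have e2 : tassoc x a (d ⊗ a) ∘ tassoc (x ⊗ a) d a ∘ (bwd (tassoc x a d) ⊗₁ idm a)
          = (idm x ⊗₁ tassoc a d a) ∘ tassoc x (a ⊗ d) a.
  by rewrite tpentagon -hcompA -bfixrM bwdK bmap1 hcompf1.
rewrite -trunit_tensor -(bmap1 (tensor C)) -(hcompA (idm x ⊗₁ _)) tassocN !bfixrM.
rewrite -!hcompA (hcompA (tassoc x a (d ⊗ a))) (hcompA (tassoc x a (d ⊗ a) ∘ _)) e2.
rewrite -(hcompA _ (fwd _)) (hcompA (fwd (tassoc x (a ⊗ d) a))) tassocN -hcompA e1.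
by rewrite -!bfixlM !hcompA zz bmap1.
Qed.

(* [_ ⊗ a] is left adjoint to [_ ⊗ d], so it preserves cokernels; one triangle
   identity of the adjunction suffices. *)
Lemma left_dual_right_exact (a d : C) :
  is_left_dual a d -> right_exact (bfixr (tensor C) a).
Proof.
move=> [ev [coev [zz _]]] x y z f p /is_cokernelP[pf ep Hp].
(* [eta] and [eps] are the unit and counit of the adjunction, [Phi] and [Psi] the transpositions
   they induce. *)
pose eta (u : C) := bwd (tassoc u a d) ∘ (idm u ⊗₁ coev) ∘ bwd (trunit u).
pose eps (w : C) := trunit w ∘ (idm w ⊗₁ ev) ∘ tassoc w d a.
pose Phi (u w : C) (g : hom (u ⊗ a) w) : hom u (w ⊗ d) := (g ⊗₁ idm d) ∘ eta u.
pose Psi (u w : C) (h : hom u (w ⊗ d)) : hom (u ⊗ a) w := eps w ∘ (h ⊗₁ idm a).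
have etaN (u v : C) (g : hom u v) : eta v ∘ g = ((g ⊗₁ idm a) ⊗₁ idm d) ∘ eta u.
  rewrite /eta -!hcompA.
  have -> : bwd (trunit v) ∘ g = (g ⊗₁ idm tunit) ∘ bwd (trunit u).
    apply: (@iso_mono _ _ _ (trunit v)); rewrite !hcompA bwdK trunitN.
    by rewrite -hcompA bwdK hcomp1f hcompf1.
  apply: (@iso_mono _ _ _ (tassoc v a d)); rewrite !hcompA bwdK tassocN.
  rewrite -(hcompA _ (fwd _)) bwdK hcomp1f hcompf1 bmap1 -!bmapM.
  by rewrite !hcomp1f !hcompf1.
have epsN (u v : C) (g : hom u v) : eps v ∘ ((g ⊗₁ idm d) ⊗₁ idm a) = g ∘ eps u.
  rewrite /eps -!hcompA tassocN bmap1 (hcompA (_ ⊗₁ ev)) -bmapM hcomp1f hcompf1.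
  rewrite -[in LHS](hcompf1 g) -[in LHS](hcomp1f ev) bmapM !hcompA trunitN.
  by [].
have PhiK (u w : C) (g : hom (u ⊗ a) w) : Psi u w (Phi u w g) = g.
  rewrite /Psi /Phi bfixrM hcompA epsN -hcompA /eps /eta.
  by rewrite left_dual_zigzag // hcompf1.
have PhiN (u v w : C) (g : hom (v ⊗ a) w) (h : hom u v) :
    Phi _ _ (g ∘ (h ⊗₁ idm a)) = Phi _ _ g ∘ h.
  by rewrite /Phi -hcompA etaN bfixrM !hcompA.
have Phi_inj (u w : C) : injective (@Phi u w).
  by move=> g h e; rewrite -(PhiK _ _ g) e.
apply/is_cokernelP; split=> /=.
- by rewrite -bfixrM pf; apply: bmap0l.
- by move=> w g h e; apply/Phi_inj/ep; rewrite -!PhiN e.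
- move=> w g gf; have [|t tE] := Hp _ (Phi _ _ g).
    by rewrite -PhiN gf /Phi bmap0l hcomp0f.
  by exists (Psi _ _ t); rewrite -[LHS]PhiK tE /Psi bfixrM hcompA.
Qed.

End Duality.

(** * The bar presentation of a module *)

Section CokernelPresentation.
Variables (k : fieldType) (C : monoidal_category k) (A : algebra C).

(** The action of [x] as a module map out of the free module on its underlying object: the last
    arrow of the bar presentation in [C]. *)
Definition regular_mact (x : modules A (regular_action C)) :
    hom (tensor_module (mobj x) (regular_module A)) x.
apply: (@module_mor _ _ _ _ (tensor_module (mobj x) (regular_module A)) x (mact x)).
by rewrite [LHS]mactA hcompA.
Defined.

Variables (M : right_action C) (n : modules A M).

(* The bar presentation of [n] is split by the unit of [A] in [M]. *)
Lemma mact_is_cokernel :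
  is_cokernel ((mact n ◁₁ idm (A : C))
               - (idm (mobj n) ◁₁ amul A) ∘ rassoc (mobj n) A A) (mact n).
Proof.
have rN (m m' : M) (f : hom m m') :
    bwd (runit m') ∘ f = (f ◁₁ idm tunit) ∘ bwd (runit m).
  apply: (@iso_mono _ _ _ (runit m')); rewrite !hcompA bwdK runitN.
  by rewrite -hcompA bwdK hcomp1f hcompf1.
apply/is_cokernelP; split.
- by rewrite hcompBr mactA hcompA subrr.
- exact: mact_epi.
- move=> w g; rewrite hcompBr => /eqP; rewrite subr_eq0 => /eqP gE.
  (* The unit of [A] inserted at [n] gives the factorization, while the unit inserted at [n ◁ A] is
     a section of the multiplication. *)
  exists (g ∘ free_unit A (mobj n)); rewrite -[LHS]hcompf1.
  have <- : (idm (mobj n) ◁₁ amul A) ∘ rassoc (mobj n) A A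
            ∘ free_unit A (mobj n ◁ A) = idm (mobj n ◁ (A : C)).
    rewrite /free_unit hcompA.
    have := act_mact1 (mobj n) (mact1 (regular_module A)).
    by rewrite /act_mact /= => ->; rewrite bwdK.
  rewrite hcompA -gE -!hcompA; congr (_ ∘ _).
  by rewrite /free_unit rN !hcompA -!bmapM !hcomp1f !hcompf1.
Qed.

End CokernelPresentation.

Section ActBalanced.
Variables (k : fieldType) (C : monoidal_category k) (A : algebra C).
Variable M : right_action C.
Local Notation RA := (modules A (regular_action C)).

Definition act_mor (m m' : M) (x x' : RA) (f : hom m m') (g : hom x x') :
  hom (act_module m x) (act_module m' x').
apply: (@module_mor _ _ _ _ (act_module m x) (act_module m' x')
          (f ◁₁ (forget g : hom (mobj x : C) _))).
rewrite /= /act_mact -hcompA rassocN !hcompA -!bmapM hcomp1f hcompf1.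
by congr (bmap _ _ _ ∘ _); exact: (forgetP g).
Defined.

Definition act_bifunctor : bifunctor M RA (modules A M).
refine (@Bifunctor k M RA (modules A M) (fun m x => act_module m x)
  (fun m m' x x' f g => act_mor f g) _ _ _ _).
- by move=> m x; apply: forget_inj; exact: bmap1.
- by move=> *; apply: forget_inj; exact: bmapM.
- by move=> *; apply: forget_inj; exact: bmapPl.
- by move=> *; apply: forget_inj; exact: bmapPr.
Defined.

Fact act_assoc_subproof (m : M) (c : C) (x : RA) :
  mact (act_module m (tensor_module c x)) ∘ (rassoc m c (mobj x) ◁₁ idm (A : C))
  = rassoc m c (mobj x) ∘ mact (act_module (m ◁ c) x).
Proof.
rewrite /= /act_mact /tensor_mact bfixlM.
rewrite -!hcompA (hcompA (_ ◁₁ fwd (tassoc _ _ _))) -rpentagon.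
by rewrite !hcompA -rassocN bmap1.
Qed.

Fact act_assoc_inv_subproof (m : M) (c : C) (x : RA) :
  mact (act_module (m ◁ c) x) ∘ (bwd (rassoc m c (mobj x)) ◁₁ idm (A : C))
  = bwd (rassoc m c (mobj x)) ∘ mact (act_module m (tensor_module c x)).
Proof.
apply: (@iso_mono _ _ _ (rassoc m c (mobj x))).
rewrite [LHS]hcompA -(act_assoc_subproof m c x) [RHS]hcompA bwdK hcomp1f.
by rewrite -hcompA -bfixrM bwdK bmap1; exact: hcompf1.
Qed.

Definition act_assoc (m : M) (c : C) (x : RA) :
  iso (act_bifunctor (m ◁ c) x) (act_bifunctor m (tensor_module c x)).
refine (@Iso (modules A M) _ _
  (@module_mor _ _ _ _ (act_module (m ◁ c) x) (act_module m (tensor_module c x))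
     _ (act_assoc_subproof m c x))
  (@module_mor _ _ _ _ (act_module m (tensor_module c x)) (act_module (m ◁ c) x)
     _ (act_assoc_inv_subproof m c x)) _ _).
- by apply: forget_inj; exact: fwdK.
- by apply: forget_inj; exact: bwdK.
Defined.

Definition act_balanced : balanced_functor M (left_modules_action A) (modules A M).
refine (@BalancedFunctor k C M (left_modules_action A) (modules A M)
  act_bifunctor act_assoc _ _ _).
- by move=> *; apply: forget_inj; exact: rassocN.
- by move=> *; apply: forget_inj; exact: rpentagon.
- by move=> *; apply: forget_inj; exact: rtriangle.
Defined.

Hypothesis abC : abelian C.
Hypothesis rexC : right_exact (bfixr (tensor C) (A : C)).
Hypothesis rexMl : forall m, right_exact (bfixl (ract M) m).
Hypothesis rexMr : forall c, right_exact (bfixr (ract M) c).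

(** A cokernel in [M] yields one in [modules A M], so right exactness of the action on [M] suffices.
    In the second variable, a cokernel of modules in [C] is first turned into one in [C], by
    [rexC]. *)
Fact act_right_exact2 : right_exact2 act_balanced.
Proof.
split=> [m x y z f p cp | n x y z f p cp].
  apply: (cokernel_of_forget (rexMr (A : C))); apply: (rexMl m).
  apply: (@forget_cokernel _ _ _ (regular_action C)) => //.
  exact: (abelian_cokernel abC).
by apply: (cokernel_of_forget (rexMr (A : C))); apply: (rexMr (mobj n : C)).
Qed.

Definition act_rex_balanced : rex_balanced M (left_modules_action A) (modules A M) :=
  RexBalanced act_right_exact2.

(* The difference of the two maps whose coequalizer descends [G] to [n]; for
   [G = act_balanced] it is the bar presentation of [n]. *)
Definition bar_mor (D : lincat k) (G : balanced_functor M (left_modules_action A) D)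
    (n : modules A M) :
    hom (G (mobj n ◁ (A : C)) (regular_module A)) (G (mobj n) (regular_module A)) :=
  bmap G (mact n) (idm (regular_module A : left_modules_action A))
  - bmap G (idm (mobj n))
      (regular_mact (regular_module A) : @hom (left_modules_action A) _ _)
    ∘ bal G (mobj n) (A : C) (regular_module A).

Definition act_bar (n : modules A M) :
    hom (act_balanced (mobj n) (regular_module A)) n.
apply: (@module_mor _ _ _ _ (act_module (mobj n) (regular_module A)) n (mact n)).
by rewrite mactA hcompA.
Defined.

Lemma act_bar_cokernel (n : modules A M) :
  is_cokernel (bar_mor act_balanced n) (act_bar n).
Proof.
apply: (cokernel_of_forget (rexMr (A : C))).
rewrite forgetB; exact: (mact_is_cokernel n).
Qed.

End ActBalanced.

(** * The universal property *)

Section Equivalence.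
Variables (C D : category) (F : functor C D).
Hypothesis fullF : forall x y (g : hom (F x) (F y)), exists f, fmap F f = g.
Hypothesis faithF : forall x y (f g : hom x y), fmap F f = fmap F g -> f = g.
Hypothesis esoF : forall d, exists c, inhabited (iso (F c) d).

Let lift x y (g : hom (F x) (F y)) : hom x y := projT1 (cid (fullF g)).
Let liftK x y (g : hom (F x) (F y)) : fmap F (lift g) = g :=
  projT2 (cid (fullF g)).
Let Q d : C := projT1 (cid (esoF d)).
Let e d : iso (F (Q d)) d := inhabited_witness (projT2 (cid (esoF d))).
Let Qmap x y (g : hom x y) : hom (Q x) (Q y) := lift (bwd (e y) ∘ g ∘ e x).

Fact Qmap1 x : Qmap (idm x) = idm (Q x).
Proof. by apply: faithF; rewrite liftK fmap1 hcompf1 fwdK. Qed.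

Fact QmapM x y z (g : hom y z) (f : hom x y) : Qmap (g ∘ f) = Qmap g ∘ Qmap f.
Proof.
apply: faithF; rewrite fmapM !liftK !hcompA -(hcompA _ (fwd (e y))) bwdK.
by rewrite hcompf1.
Qed.

Let Qf : functor D C := Functor Qmap1 QmapM.

Fact unitN x y (f : hom x y) :
  lift (bwd (e (F y))) ∘ fmap (id_functor C) f
  = fmap (comp_functor Qf F) f ∘ lift (bwd (e (F x))).
Proof.
apply: faithF; rewrite !fmapM !liftK /=.
by rewrite -!hcompA bwdK hcompf1.
Qed.

Fact counitN x y (f : hom x y) :
  fwd (e y) ∘ fmap (comp_functor F Qf) f = fmap (id_functor D) f ∘ fwd (e x).
Proof. by rewrite /= liftK !hcompA bwdK hcomp1f. Qed.

Fact unit_iso x : is_iso (lift (bwd (e (F x)))).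
Proof.
exists (lift (e (F x))); split; apply: faithF;
  by rewrite fmapM !liftK fmap1 ?bwdK ?fwdK.
Qed.

(** The counit is the chosen isomorphism [e] and the unit is the preimage under [F] of its inverse.
    The first triangle is then immediate, and the second follows from faithfulness. *)
Lemma adjoint_equivalence_of_ff_eso : inhabited (adjoint_equivalence F).
Proof.
constructor; exists Qf
  (@NatIso _ _ _ _ (@NatTrans _ _ (id_functor C) (comp_functor Qf F) _ unitN)
    unit_iso)
  (@NatIso _ _ _ _ (@NatTrans _ _ (comp_functor F Qf) (id_functor D) _ counitN)
    (fun x => iso_is_iso (e x))).
- by move=> x /=; rewrite liftK bwdK.
- by move=> y; apply: faithF; rewrite fmapM !liftK fmap1 -!hcompA bwdK hcompf1 fwdK.
Qed.

End Equivalence.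

Section CokernelDescent.
Variables (k : fieldType) (D : lincat k).

Definition coker_desc (x y z w : D) (f : hom x y) (p : hom y z)
    (cp : is_cokernel f p) (g : hom y w) (gf : g ∘ f = 0) : hom z w :=
  projT1 (cid (cp.2 w g gf)).

Lemma coker_descE (x y z w : D) (f : hom x y) (p : hom y z)
    (cp : is_cokernel f p) (g : hom y w) (gf : g ∘ f = 0) :
  coker_desc cp gf ∘ p = g.
Proof. exact: (projT2 (cid (cp.2 w g gf))).1. Qed.

End CokernelDescent.

(** * Bar presentations for balanced functors *)

Section BalancedBar.
Variables (k : fieldType) (C : monoidal_category k) (A : algebra C).
Variables (M : right_action C) (D : lincat k).
Local Notation RA := (left_modules_action A).
Local Notation reg := (regular_module A : RA).
Implicit Types G H : balanced_functor M RA D.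

(** The last arrow of the presentation of [G m x]: the balancing moves [x] to the right, where its
    action absorbs [A]. *)
Definition bar_aug G (m : M) (x : modules A (regular_action C)) :
    hom (G (m ◁ (mobj x : C)) reg) (G m x) :=
  bmap G (idm m) (regular_mact x : @hom RA _ _) ∘ bal G m (mobj x : C) reg.

Lemma bar_morN G H (a : balanced_trans G H) (n : modules A M) :
  a (mobj n) reg ∘ bar_mor G n = bar_mor H n ∘ a (mobj n ◁ (A : C)) reg.
Proof.
rewrite /bar_mor hcompBr hcompBl btN; congr (_ - _).
by rewrite hcompA btN -!hcompA; congr (_ ∘ _); exact: btB.
Qed.

Lemma bar_augN G H (a : balanced_trans G H) (m : M)
    (x : modules A (regular_action C)) :
  a m x ∘ bar_aug G m x = bar_aug H m x ∘ a (m ◁ (mobj x : C)) reg.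
Proof.
by rewrite /bar_aug hcompA btN -!hcompA; congr (_ ∘ _); exact: btB.
Qed.

Lemma bar_mor_map G (n n' : modules A M) (f : hom n n') :
  bmap G (forget f) (idm reg) ∘ bar_mor G n
  = bar_mor G n' ∘ bmap G (forget f ◁₁ idm (A : C)) (idm reg).
Proof.
rewrite /bar_mor hcompBr hcompBl -!bmapM forgetP; congr (_ - _).
rewrite hcompA -!bmapM hcompf1 hcomp1f.
by rewrite -hcompA balN hcompA -bmapM bmap1 hcomp1f hcompf1.
Qed.

Lemma bar_aug_map G (m m' : M) (x x' : RA) (f : hom m m') (g : hom x x') :
  bmap G f g ∘ bar_aug G m x
  = bar_aug G m' x'
    ∘ bmap G (f ◁₁ (forget g : hom (mobj x : C) (mobj x'))) (idm reg).
Proof.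
rewrite /bar_aug -hcompA balN !hcompA -!bmapM hcompf1 hcomp1f.
congr (bmap _ _ _ ∘ _); apply: forget_inj; exact: (esym (forgetP g)).
Qed.

End BalancedBar.

Section PointwiseIso.

Lemma nat_trans_inv (C D : category) (F G : functor C D) (a : nat_trans F G) :
  (forall x, is_iso (a x)) -> exists b : nat_trans G F,
    (forall x, b x ∘ a x = idm (F x)) /\ (forall x, a x ∘ b x = idm (G x)).
Proof.
move=> ia; pose b x := projT1 (cid (ia x)).
have ba x : b x ∘ a x = idm (F x) := (projT2 (cid (ia x))).1.
have ab x : a x ∘ b x = idm (G x) := (projT2 (cid (ia x))).2.
have bN x y (f : hom x y) : b y ∘ fmap G f = fmap F f ∘ b x.
  by rewrite -[LHS]hcompf1 -ab !hcompA -(hcompA (b y)) -ntN hcompA ba hcomp1f.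
by exists (NatTrans bN).
Qed.

Lemma balanced_trans_inv (k : fieldType) (C : monoidal_category k)
    (M : right_action C) (N : left_action C) (D : lincat k)
    (F G : balanced_functor M N D) (a : balanced_trans F G) :
  (forall m n, is_iso (a m n)) -> exists b : balanced_trans G F,
    (forall m n, b m n ∘ a m n = idm (F m n)) /\
    (forall m n, a m n ∘ b m n = idm (G m n)).
Proof.
move=> ia; pose b m n := projT1 (cid (ia m n)).
have ba m n : b m n ∘ a m n = idm (F m n) := (projT2 (cid (ia m n))).1.
have ab m n : a m n ∘ b m n = idm (G m n) := (projT2 (cid (ia m n))).2.
have bN m m' n n' (f : hom m m') (g : hom n n') :
    b m' n' ∘ bmap G f g = bmap F f g ∘ b m n.
  by rewrite -[LHS]hcompf1 -ab !hcompA -(hcompA (b _ _)) -btN hcompA ba hcomp1f.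
have bB m (c : C) n : b m (c ▷ n) ∘ bal G m c n = bal F m c n ∘ b (m ◁ c) n.
  by rewrite -[LHS]hcompf1 -ab !hcompA -(hcompA (b _ _)) -btB hcompA ba hcomp1f.
by exists (BalancedTrans bN bB).
Qed.

End PointwiseIso.

(** * Descent of balanced functors to module objects *)

Section Descent.
Variables (k : fieldType) (C : monoidal_category k) (A : algebra C).
Variables (M : right_action C) (D : lincat k).
Local Notation RA := (left_modules_action A).
Local Notation reg := (regular_module A : RA).

(** This is the balancing pentagon for [c] and the object under [x]; it will make [descent_cmp]
    compatible with the balancings. *)
Lemma bar_aug_bal (G : balanced_functor M RA D) (m : M) (c : C) (x : RA) :
  bar_aug G m (c ▷ x) ∘ bmap G (rassoc m c (mobj x : C)) (idm reg)
  = bal G m c x ∘ bar_aug G (m ◁ c) x.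
Proof.
rewrite /bar_aug [in RHS]hcompA -(bmap1 (ract M)) balN -[RHS]hcompA.
have E := bal_pentagon G m c (mobj x : C) reg.
transitivity (bmap G (idm m) (idm c ▷₁ (regular_mact x : @hom RA _ _))
  ∘ (bmap G (idm m) (lassoc c (mobj x : C) reg) ∘ bal G m (c ⊗ mobj x) reg
     ∘ bmap G (rassoc m c (mobj x : C)) (idm reg))).
  rewrite !hcompA -bmapM hcomp1f; congr (bmap _ _ _ ∘ _ ∘ _).
  exact: forget_inj.
by rewrite -E.
Qed.

Hypothesis rexC : right_exact (bfixr (tensor C) (A : C)).

Lemma bar_aug_cokernel (G : balanced_functor M RA D) (m : M) (x : RA) :
  right_exact2 G ->
  is_cokernel (bar_mor G (act_module m x)) (bar_aug G m x).
Proof.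
move=> [rexG _].
(* [d] is the bar presentation of [x] in [C]. The functor [G m] preserves its cokernel, and the
   balancings identify its image with [bar_mor]. *)
pose d : @hom RA ((mobj x ⊗ (A : C)) ▷ reg) ((mobj x : C) ▷ reg) :=
  ((mact x : hom (mobj x ⊗ (A : C)) (mobj x : C)) ▷₁ idm reg)
  - (idm (mobj x : C) ▷₁ (regular_mact reg : @hom RA _ _))
    ∘ lassoc (mobj x : C) (A : C) reg.
have cd : is_cokernel d (regular_mact x).
  apply: (@cokernel_of_forget _ _ A (regular_action C) rexC).
  by rewrite forgetB; exact: (mact_is_cokernel x).
apply: (@cokernel_of_isos _ _ _ _ _ _ _ _ _
  (bal G m (mobj x ⊗ (A : C)) reg ∘ bmap G (rassoc m (mobj x : C) (A : C)) (idm reg))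
  (bwd (bal G m (mobj x : C) reg)) _ _ _ (bwdK _) (fwdK _) _ (rexG m _ _ _ _ _ cd)).
- apply: epi_comp; first exact: iso_epi.
  exact: (@iso_epi _ _ _ (fmap_iso (bfixr G reg) (rassoc m (mobj x : C) (A : C)))).
- rewrite /= /d /bar_mor bmapBr hcompBl hcompBr; congr (_ - _).
    rewrite /= /act_mact bfixrM !hcompA; congr (_ ∘ _).
    exact: (balN G (idm m) (mact x : hom (mobj x ⊗ (A : C)) (mobj x : C)) (idm reg)).
  rewrite !hcompA -[idm (mobj (act_module m x))](bmap1 (ract M)) balN.
  have E := bal_pentagon G m (mobj x : C) (A : C) reg.
  rewrite bfixlM -!hcompA; congr (_ ∘ _).
  by rewrite -hcompA in E; exact: E.
Qed.

Section Construction.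
Variable G : rex_balanced M RA D.
Hypothesis abD : abelian D.
Hypothesis rexM : right_exact (bfixr (ract M) (A : C)).
Hypothesis abM : abelian M.

Definition descent_ob (n : modules A M) : D :=
  projT1 (cid (abelian_cokernel abD (bar_mor G n))).

Definition descent_pi (n : modules A M) : hom (G (mobj n) reg) (descent_ob n) :=
  projT1 (cid (projT2 (cid (abelian_cokernel abD (bar_mor G n))))).

Lemma descent_piP n : is_cokernel (bar_mor G n) (descent_pi n).
Proof.
exact: (projT2 (cid (projT2 (cid (abelian_cokernel abD (bar_mor G n)))))).
Qed.

Fact descent_map_subproof (n n' : modules A M) (f : hom n n') :
  descent_pi n' ∘ bmap G (forget f) (idm reg) ∘ bar_mor G n = 0.
Proof.
by rewrite -hcompA bar_mor_map hcompA (descent_piP n').1 hcomp0f.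
Qed.

Definition descent_map (n n' : modules A M) (f : hom n n') :
    hom (descent_ob n) (descent_ob n') :=
  coker_desc (descent_piP n) (descent_map_subproof f).

Lemma descent_mapE (n n' : modules A M) (f : hom n n') :
  descent_map f ∘ descent_pi n = descent_pi n' ∘ bmap G (forget f) (idm reg).
Proof. exact: coker_descE. Qed.

Lemma descent_pi_epi n : epi (descent_pi n).
Proof. exact: cokernel_epi (descent_piP n). Qed.

Definition descent_functor : functor (modules A M) D.
refine (@Functor (modules A M) D descent_ob (fun n n' f => descent_map f) _ _).
- move=> n; apply: descent_pi_epi; rewrite descent_mapE forget_id bmap1.
  by rewrite hcompf1 hcomp1f.
- move=> x y z g f; apply: descent_pi_epi; rewrite descent_mapE forget_comp bfixrM.
  by rewrite -hcompA descent_mapE !hcompA descent_mapE.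
Defined.

Definition descent_linfunctor : linfunctor (modules A M) D.
refine (@LinFunctor k (modules A M) D descent_functor _).
move=> x y a f g; apply: descent_pi_epi; rewrite /= hcompPl !descent_mapE.
by rewrite -hcompPr -bmapPl.
Defined.

(** Cokernels commute with cokernels: a map out of [descent_ob y] that kills the image of [f]
    descends first along [p], since [G] is right exact, and then along the bar presentation of
    [z]. *)
Lemma descent_right_exact : right_exact descent_linfunctor.
Proof.
move=> x y z f p cp.
have cp' := forget_cokernel rexM (abelian_cokernel abM _) cp.
have cG : is_cokernel (bmap G (forget f) (idm reg)) (bmap G (forget p) (idm reg)) :=
  (rexbP G).2 reg _ _ _ _ _ cp'.
have epA : epi (bmap G (forget p ◁₁ idm (A : C)) (idm reg)).
  exact: (cokernel_epi ((rexbP G).2 reg _ _ _ _ _ (rexM cp'))).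
apply/is_cokernelP; split=> /=.
- apply: descent_pi_epi; rewrite hcomp0f -hcompA descent_mapE hcompA descent_mapE.
  by rewrite -hcompA cG.1 hcompf0.
- apply: (@epi_cancel _ _ _ _ _ (descent_pi y)); rewrite descent_mapE.
  by apply: epi_comp; [exact: descent_pi_epi | exact: cokernel_epi cG].
- move=> w g gf; have [|t [tE _]] := cG.2 _ (g ∘ descent_pi y).
    by rewrite -hcompA -descent_mapE hcompA gf hcomp0f.
  (* That [t] kills the bar map of [z] is tested on the epimorphism of [epA], where it reduces to
     the bar map of [y]. *)
  have [|u [uE _]] := (descent_piP z).2 _ t.
    apply: epA; rewrite hcomp0f -hcompA -bar_mor_map hcompA tE -hcompA.
    by rewrite (descent_piP y).1 hcompf0.
  exists u; apply: descent_pi_epi.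
  by rewrite -hcompA descent_mapE hcompA uE tE.
Qed.

Definition descent_rex : rex_functor (modules A M) D :=
  RexFunctor descent_right_exact.

End Construction.
End Descent.

Section UniversalProperty.
Variables (k : fieldType) (C : monoidal_category k) (A : algebra C).
Variable M : right_action C.
Local Notation RA := (left_modules_action A).
Local Notation reg := (regular_module A : RA).
Hypothesis abC : abelian C.
Hypothesis abM : abelian M.
Hypothesis rexC : right_exact (bfixr (tensor C) (A : C)).
Hypothesis rexMl : forall m, right_exact (bfixl (ract M) m).
Hypothesis rexMr : forall c, right_exact (bfixr (ract M) c).
Let B : rex_balanced M RA (modules A M) := act_rex_balanced abC rexC rexMl rexMr.

Section Target.
Variable D : lincat k.
Hypothesis abD : abelian D.

Section Comparison.
Variable G : rex_balanced M RA D.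
Let F := descent_rex G abD (rexMr (A : C)) abM.

Definition descent_cmp (m : M) (x : RA) :
    hom (comp_balanced B F m x) (G m x) :=
  coker_desc (descent_piP G abD (act_module m x))
    (bar_aug_cokernel rexC m x (rexbP G)).1.

Lemma descent_cmpE (m : M) (x : RA) :
  descent_cmp m x ∘ descent_pi G abD (act_module m x) = bar_aug G m x.
Proof. exact: coker_descE. Qed.

(** [descent_pi] and [bar_aug] are cokernels of the same morphism. *)
Lemma descent_cmp_iso (m : M) (x : RA) : is_iso (descent_cmp m x).
Proof.
have [i iE] := cokernel_iso (descent_piP G abD (act_module m x))
  (bar_aug_cokernel rexC m x (rexbP G)).
suff -> : descent_cmp m x = fwd i by exact: iso_is_iso.
by apply: (@descent_pi_epi _ _ _ _ _ G abD (act_module m x)); rewrite descent_cmpE.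
Qed.

(** Essential surjectivity of precomposition. The comparison maps are natural and balanced because,
    after the epimorphism [descent_pi], these laws become those of [bar_aug]. *)
Lemma descent_comparison :
  inhabited (@iso (rex_balanced_category M RA D) (precomp D B F) G).
Proof.
have N m m' (x x' : RA) (f : hom m m') (g : hom x x') :
    descent_cmp m' x' ∘ bmap (comp_balanced B F) f g
    = bmap G f g ∘ descent_cmp m x.
  apply: (@descent_pi_epi _ _ _ _ _ G abD (act_module m x)).
  rewrite -[RHS]hcompA descent_cmpE bar_aug_map -hcompA.
  rewrite [X in _ ∘ X](descent_mapE G abD (act_mor f g)) hcompA descent_cmpE.
  by [].
have Bal m (c : C) (x : RA) :
    descent_cmp m (c ▷ x) ∘ bal (comp_balanced B F) m c x
    = bal G m c x ∘ descent_cmp (m ◁ c) x.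
  apply: (@descent_pi_epi _ _ _ _ _ G abD (act_module (m ◁ c) x)).
  rewrite -[RHS]hcompA descent_cmpE -bar_aug_bal -hcompA.
  rewrite [X in _ ∘ X](descent_mapE G abD (fwd (act_assoc m c x))).
  rewrite hcompA descent_cmpE.
  by [].
pose a := BalancedTrans N Bal.
have [b [ba ab]] := balanced_trans_inv (a := a) descent_cmp_iso.
by exists; exists a b; apply: balanced_trans_eq.
Qed.

End Comparison.

Lemma bar_mor_comp (F : linfunctor (modules A M) D) (n : modules A M) :
  bar_mor (comp_balanced B F) n = fmap F (bar_mor B n).
Proof. by rewrite /bar_mor fmapB fmapM. Qed.

Lemma act_bar_aug (F : linfunctor (modules A M) D) (m : M) (x : RA) :
  bar_aug (comp_balanced B F) m x = fmap F (act_bar (act_module m x)).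
Proof.
rewrite /bar_aug /= -fmapM; congr (fmap F _); exact: forget_inj.
Qed.

Section FullyFaithful.
Variables F H : rex_functor (modules A M) D.

Lemma bar_cokernel_map (n : modules A M) :
  is_cokernel (bar_mor (comp_balanced B F) n) (fmap F (act_bar n)).
Proof. by rewrite bar_mor_comp; apply: rexP; apply: act_bar_cokernel. Qed.

(** [F] sends [act_bar n] to an epimorphism, so a component at [n] is determined by the one at the
    free module on [n]. *)
Lemma precomp_faithful (a b : nat_trans F H) :
  (forall m x, a (B m x) = b (B m x)) -> a = b.
Proof.
move=> ab; apply: nat_trans_eq => n.
apply: (cokernel_epi (bar_cokernel_map n)).
rewrite !ntN; congr (_ ∘ _); exact: (ab (mobj n) reg).
Qed.

(** The component at [n] is induced on cokernels by [a] at the free module on [n]. At [B m x] it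
    agrees with [a] because [a] commutes with the augmentations. *)
Lemma precomp_full (a : balanced_trans (comp_balanced B F) (comp_balanced B H)) :
  exists b : nat_trans F H, forall m x, b (B m x) = a m x.
Proof.
have a0 n : fmap H (act_bar n) ∘ a (mobj n) reg ∘ bar_mor (comp_balanced B F) n = 0.
  rewrite -hcompA [X in _ ∘ X](bar_morN a n) hcompA bar_mor_comp.
  rewrite -[X in X ∘ _]fmapM (act_bar_cokernel rexMr n).1.
  by rewrite fmap0 hcomp0f.
pose b n := coker_desc (bar_cokernel_map n) (a0 n).
have bE n : b n ∘ fmap F (act_bar n) = fmap H (act_bar n) ∘ a (mobj n) reg.
  exact: coker_descE.
have barN (n n' : modules A M) (f : hom n n') :
    f ∘ act_bar n = act_bar n' ∘ bmap B (forget f) (idm reg).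
  by apply: forget_inj; rewrite !forget_comp /= forgetP.
have bN n n' (f : hom n n') : b n' ∘ fmap F f = fmap H f ∘ b n.
  apply: (cokernel_epi (bar_cokernel_map n)).
  rewrite -hcompA -fmapM barN fmapM hcompA bE -[LHS]hcompA.
  rewrite [X in _ ∘ X](btN a (forget f) (idm reg)) hcompA -fmapM -barN fmapM.
  by rewrite -!hcompA bE.
exists (NatTrans bN) => m x /=; apply: (cokernel_epi (bar_cokernel_map _)).
have e := bar_augN a m x; rewrite !act_bar_aug in e.
by apply: (etrans (bE (act_module m x))); exact: (esym e).
Qed.

End FullyFaithful.

Lemma act_universal : inhabited (adjoint_equivalence (precomp D B)).
Proof.
apply: adjoint_equivalence_of_ff_eso.
- move=> F H a; have [b bE] := precomp_full a.
  by exists b; apply: balanced_trans_eq.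
- move=> F H a b ab; apply: precomp_faithful => m x.
  by have := congr1 (fun t : balanced_trans _ _ => t m x) ab.
- by move=> G; have i := descent_comparison G; eexists; exact: i.
Qed.

End Target.

Definition act_relative_tensor_product (fa : finite_abelian (modules A M)) :
    relative_tensor_product M RA :=
  @RelativeTensorProduct k C M RA (modules A M) fa B
    (fun D faD => inhabited_witness (act_universal (fa_abelian faD))).

End UniversalProperty.

(** * Uniqueness of relative tensor products *)

Section Uniqueness.
Variables (k : fieldType) (C : monoidal_category k).
Variables (M : right_action C) (N : left_action C).

Fact id_functor_linear (D : lincat k) (x y : D) (a : k) (f g : hom x y) :
  fmap (id_functor D) (a *: f + g)
  = a *: fmap (id_functor D) f + fmap (id_functor D) g.
Proof. by []. Qed.

Definition id_rex (D : lincat k) : rex_functor D D :=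
  @RexFunctor k D D (LinFunctor (@id_functor_linear D)) (fun _ _ _ _ _ => id).

Fact comp_functor_linear (D E E' : lincat k) (G : linfunctor E E')
    (F : linfunctor D E) (x y : D) (a : k) (f g : hom x y) :
  fmap (comp_functor G F) (a *: f + g)
  = a *: fmap (comp_functor G F) f + fmap (comp_functor G F) g.
Proof. by rewrite /= !fmapP. Qed.

Definition comp_rex (D E E' : lincat k) (G : rex_functor E E')
    (F : rex_functor D E) : rex_functor D E' :=
  @RexFunctor k D E' (LinFunctor (@comp_functor_linear D E E' G F))
    (fun x y z f p cp => rexP G (rexP F cp)).

Lemma adjoint_equivalence_reflects_iso (X Y : category) (F : functor X Y) :
  adjoint_equivalence F -> forall x y, iso (F x) (F y) -> inhabited (iso x y).
Proof.
move=> [Q u e t1 t2] x y i.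
have [ux uxE] := is_iso_iso (nat_isoP u x).
have [uy uyE] := is_iso_iso (nat_isoP u y).
have [j _] := is_iso_iso (is_iso_comp (iso_is_iso (iso_inv uy))
  (is_iso_comp (iso_is_iso (fmap_iso Q i)) (iso_is_iso ux))).
by exists.
Qed.

Lemma rex_iso_nat_iso (D E : lincat k) (F G : rex_functor D E) :
  @iso (rex_category D E) F G -> inhabited (nat_iso F G).
Proof.
move=> [a b ba ab]; exists; exists a => x; exists (b x).
split; first exact: (congr1 (fun t : nat_trans F F => t x) ba).
exact: (congr1 (fun t : nat_trans G G => t x) ab).
Qed.

Lemma nat_iso_inv (X Y : category) (F G : functor X Y) :
  nat_iso F G -> inhabited (nat_iso G F).
Proof.
move=> a; have [b [ba ab]] := nat_trans_inv (nat_isoP a).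
by exists; exists b => x; exists (a x).
Qed.

Lemma rex_balanced_iso_component (D : lincat k) (F G : rex_balanced M N D)
    (a : @iso (rex_balanced_category M N D) F G) m n :
  is_iso ((fwd a : balanced_trans F G) m n).
Proof.
case: a => a b ba ab; exists ((b : balanced_trans G F) m n); split.
  exact: (congr1 (fun t : balanced_trans F F => t m n) ba).
exact: (congr1 (fun t : balanced_trans G G => t m n) ab).
Qed.

(** Restricted along the universal functor of [T], both [G ∘ F] and the identity become isomorphic
    to it as balanced functors, and precomposition with it reflects isomorphism. *)
Lemma relative_tensor_round_trip (T T' : relative_tensor_product M N)
    (F : rex_functor T T') (G : rex_functor T' T) :
  @iso (rex_balanced_category M N T') (precomp T' (rtp_fun T) F) (rtp_fun T') ->
  @iso (rex_balanced_category M N T) (precomp T (rtp_fun T') G) (rtp_fun T) ->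
  inhabited (nat_iso (comp_functor G F) (id_functor T)).
Proof.
move=> ia ib; have E := rtp_univ T (rtp_finite T).
pose a : balanced_trans (comp_balanced (rtp_fun T) F) (rtp_fun T') := fwd ia.
pose b : balanced_trans (comp_balanced (rtp_fun T') G) (rtp_fun T) := fwd ib.
pose GF := comp_balanced (rtp_fun T) (comp_rex G F).
pose c m n : hom (GF m n) (comp_balanced (rtp_fun T) (id_rex T) m n) :=
  b m n ∘ fmap G (a m n).
have cN m m' n n' (f : hom m m') (g : hom n n') :
    c m' n' ∘ bmap GF f g = bmap (rtp_fun T) f g ∘ c m n.
  have e := congr1 (fmap G) (btN a f g); rewrite !fmapM in e.
  rewrite /c -[LHS]hcompA; apply: (etrans (congr1 (hcomp (b m' n')) e)).
  by rewrite [LHS]hcompA [RHS]hcompA; congr (_ ∘ _); exact: (btN b f g).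
have cB m (d : C) n : c m (d ▷ n) ∘ bal GF m d n
    = bal (comp_balanced (rtp_fun T) (id_rex T)) m d n ∘ c (m ◁ d) n.
  have e := congr1 (fmap G) (btB a m d n); rewrite !fmapM in e.
  rewrite /c -[LHS]hcompA; apply: (etrans (congr1 (hcomp (b m (d ▷ n))) e)).
  by rewrite [LHS]hcompA [RHS]hcompA; congr (_ ∘ _); exact: (btB b m d n).
pose t := @BalancedTrans _ _ _ _ _ GF (comp_balanced (rtp_fun T) (id_rex T)) c cN cB.
have [|s [st ts]] := balanced_trans_inv (a := t).
  move=> m n; apply: is_iso_comp; first exact: (rex_balanced_iso_component ib m n).
  have [i iE] := is_iso_iso (rex_balanced_iso_component ia m n).
  by rewrite -/(fwd ia) -iE; exact: (iso_is_iso (fmap_iso G i)).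
have i : @iso (rex_balanced_category M N T)
    (precomp T (rtp_fun T) (comp_rex G F)) (precomp T (rtp_fun T) (id_rex T)).
  by exists t s; apply: balanced_trans_eq.
have [j] := adjoint_equivalence_reflects_iso E i.
exact: (rex_iso_nat_iso j).
Qed.

(** Each universal functor factors through the other, as the chosen quasi-inverse shows, and both
    round trips are isomorphic to identities. *)
Lemma relative_tensor_product_unique (T T' : relative_tensor_product M N) :
  linear_equivalent T T'.
Proof.
have factor (U V : relative_tensor_product M N) : exists F : rex_functor U V,
    inhabited (@iso (rex_balanced_category M N V)
      (precomp V (rtp_fun U) F) (rtp_fun V)).
  have [Q u e _ _] := rtp_univ U (rtp_finite V); exists (Q (rtp_fun V)).
  by have [i _] := is_iso_iso (nat_isoP e (rtp_fun V)); exists.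
have [F [a]] := factor T T'; have [G [b]] := factor T' T.
have [i] := relative_tensor_round_trip a b.
have [j] := relative_tensor_round_trip b a.
have [i'] := nat_iso_inv i.
by exists F, G.
Qed.

End Uniqueness.

(** [modules A M] with the action is itself a relative tensor product, which gives existence;
    uniqueness then yields the equivalence for every other one. *)
Theorem proposition3p10 (k : fieldType) (C : finite_tensor_category k)
    (M : right_module_category C) (A : algebra C) :
  inhabited (relative_tensor_product M (left_modules_action A)) /\
  forall T : relative_tensor_product M (left_modules_action A),
    linear_equivalent T (modules A M).
Proof.
(* The dual of [A] makes [_ ⊗ A] right exact. *)
have [d dP] := ft_left_dual (A : C).
have faMod : finite_abelian (modules A M).
  by apply: modules_finite_abelian (rm_finite M) ((rm_exact M).2 _).
pose P := act_relative_tensor_product (fa_abelian (ft_finite C))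
  (fa_abelian (rm_finite M)) (left_dual_right_exact dP)
  (fun m => ((rm_exact M).1 m).2) (fun c => ((rm_exact M).2 c).2) faMod.
split; first by exists; exact: P.
by move=> T; exact: (relative_tensor_product_unique T P).
Qed.
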